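(* Let $M>1$ be real, $n\in\mathbb{N}=\{1,2,\dots\}$, $v\in\left[0,\frac{(M-1)n}{(n-1)M}\right]$ (upper endpoint $+\infty$ if $n=1$), and let $(\alpha^*,\beta^* )=(\alpha^*(v),\beta^*(v))$ be the stepsize schedule defined in the context. Let $\Omega=\{0,1^{(1)},\dots,1^{(n)},*\}$ and define $$\lambda_{i,*}=\frac{\alpha^*+\beta^*-\alpha^*\beta^*}{n(1+M-\alpha^*+M\alpha^* )},\qquad \lambda_{*,i}=\frac{M\beta^*+\alpha^*(-1+M\beta^* )}{Mn(1+M-\alpha^*+M\alpha^* )}\qquad \forall i\in\Omega\setminus\{0,*\},$$ $$\lambda_{0,*}=0,\qquad \lambda_{*,0}=n(\lambda_{1^{(1)},*}-\lambda_{*,1^{(1)}}),$$ $$\lambda_{0,i}=\frac{n^2(\lambda_{1^{(1)},*}+M\lambda_{*,1^{(1)}})^2-n(\lambda_{1^{(1)},*}+\lambda_{*,1^{(1)}})}{2(n-nv+v)}+\frac{\lambda_{1^{(1)},*}-\lambda_{*,1^{(1)}}}{2}\qquad\forall i\in\Omega\setminus\{0,*\},$$ $$\lambda_{i,0}=\frac{n^2(\lambda_{1^{(1)},*}+M\lambda_{*,1^{(1)}})^2-n(\lambda_{1^{(1)},*}+\lambda_{*,1^{(1)}})}{2(n-nv+v)}-\frac{\lambda_{1^{(1)},*}-\lambda_{*,1^{(1)}}}{2}\qquad\forall i\in\Omega\setminus\{0,*\},$$ $$\lambda_{i,j}=0\qquad\forall i,j\in\Omega\setminus\{0,*\},\ i\ne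 j,$$ $$\tau=1-M\Bigl(\lambda_{0,*}+\lambda_{*,0}+\sum_{i=1}^n\lambda_{1^{(i)},*}+\sum_{i=1}^n\lambda_{*,1^{(i)}}\Bigr).$$ If $n=1$, let $\mu_0=\mu_1=0$. If $n>1$, let $$\mu_0=\max\Bigl\{0,\ \tfrac{n^2-(n-1)^2v^2}{(n-1)v}(\lambda_{0,1^{(1)}}+\lambda_{1^{(1)},0})+n(\lambda_{0,1^{(1)}}+\lambda_{1^{(1)},0})-2\alpha^*n(\lambda_{0,1^{(1)}}+M\lambda_{1^{(1)},0})+(\lambda_{0,*}+\lambda_{*,0})\Bigr\},$$ $$\mu_i=\max\Bigl\{0,\ \bigl(1-\tfrac{(n-1)v}{n}\bigr)(\lambda_{0,1^{(1)}}+\lambda_{1^{(1)},0})+(\lambda_{*,1^{(1)}}+\lambda_{1^{(1)},*})\Bigr\}\qquad\forall i\in\{1,\dots,n\}.$$ Then the following hold. (i) All of $\tau$, $\mu_i$ ($0\le i\le n$) and $\lambda_{i,j}$ ($i,j\in\Omega$, $i\neq j$) are non-negative. (ii) With $(\alpha,\beta)=(\alpha^*,\beta^* )$ in the matrices defined in the context, $$\tau\bar A_R+\sum_{i=0}^n\mu_i\bar A_i^{\mathrm{var}}-\sum_{(i,j)\in\Omega\times\Omega,\ i\ne j}\lambda_{i,j}\bar B_{i,j}-\bar C\succeq \mathbf{0}\qquad\text{and}\qquad \sum_{i\in\Omega\setminus\{j\}}\lambda_{i,j}=\sum_{i\in\Omega\setminus\{j\}}\lambda_{j,i}\quad\forall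 j\in\Omega.$$ (iii) For all $R,\sigma>0$, the number $\tau R^2+\sum_{i=0}^n\mu_i\sigma^2$ is an upper bound on the optimal value of the two-step performance estimation problem defined in the context with $(\alpha,\beta)=(\alpha^*,\beta^* )$; that is, $$\mathbb{E}_{\xi_0,\xi_1}\bigl[\|x_2-x_*\|^2\bigr]\le\tau R^2+\sum_{i=0}^n\mu_i\sigma^2$$ for every feasible instance.
   Context: **Conventions.** For $n=1$, $\frac{(M-1)n}{(n-1)M}=+\infty$ and $v$ is any nonnegative real. For $n>1$ and $v=0$, the expression with $(n-1)v$ in the denominator is read as $+\infty$, so $\mu_0=+\infty$; then the bound in (iii) is trivial, and the semidefinite constraint in (ii) is read in the extended sense, i.e. the quadratic form $u\mapsto u^\top(\cdot)u$ is nonnegative for every $u$, where $\mu_0\,u^\top\bar A_0^{\mathrm{var}}u$ is $+\infty$ if $u^\top\bar A_0^{\mathrm{var}}u>0$ and $0$ otherwise. **The schedule $(\alpha^*,\beta^* )$.** Given $(M,n,v)$, $\alpha^*$ is the unique element of $[\frac1M,1)$ solving $$0=(M-1)Mn\,\alpha^3-(M+1)(M-2)n\,\alpha^2-(4n+(M-1)(n-1)v)\alpha+2n,$$ and $\beta^*$ is the unique element of $(\frac{\alpha^*}{M},\frac{M+1}{2M})$ such that $(\alpha,\beta)=(\alpha^*,\beta^* )$ satisfies $$\begin{aligned} 0=\ & Mn\left((M-1)^2n+(M+1)^2(n-1)v\right)\left((M-1)\alpha+(M+1)\right)\beta^2\\ &+2M\Bigl[2(M-1)Mn(-n+(n-1)v)\alpha^2+(1+M)(-n+(n-1)v)\bigl((3-M)n+(M-1)(n-1)v\bigr)\alpha\\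 &\qquad+n\bigl(n-(M-4)Mn-(1+M)(3+M)(n-1)v\bigr)\Bigr]\beta\\ &+\Bigl[-2M(M^2-1)n(-n+(n-1)v)\alpha^2\\ &\qquad+\bigl(2(2+M+2M^2-M^3)n^2+(M-3)(1+M)^2(n-1)nv+(1-M)(1+M)^2(n-1)^2v^2\bigr)\alpha\\ &\qquad+2(1+M)^2n(-n+(n-1)v)\Bigr]. \end{aligned}$$ (Existence and uniqueness of $\alpha^*,\beta^*$ are known.) **Two-step performance estimation problem (PEP).** Throughout the strong convexity parameter is $m=1$. Let $\mathcal{F}_{1,M}$ be the class of proper, closed, $1$-strongly convex functions $f:\mathbb{R}^d\to\mathbb{R}$ with $M$-Lipschitz gradient ($d$ arbitrary). For stepsizes $\alpha,\beta>0$, the problem is to take the supremum of $\mathbb{E}_{\xi_0,\xi_1}[\|x_2-x_*\|^2]$ over all $f\in\mathcal{F}_{1,M}$ with $\nabla f(x_* )=\mathbf 0$, all $x_0$ with $\|x_0-x_*\|^2\le R^2$, and all stochastic gradients $g$, where $x_1=x_0-\alpha g(x_0,\xi_0)$ and $x_2=x_1-\beta g(x_1,\xi_1)$, and at every queried point $x$ the stochastic gradient takes $n$ equally likely values $g(x,\xi^{(1)}),\dots,g(x,\xi^{(n)})$ with $\frac1n\sum_i g(x,\xi^{(i)})=\nabla f(x)$ and $\frac1n\sum_i\|g(x,\xi^{(i)})-\nabla f(x)\|^2\le\sigma^2$. Explicitly: $x_{1^{(i)}}=x_0-\alpha g(x_0,\xi_0^{(i)})$ for $i=1,\dots,n$,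 the mean and variance conditions hold at $x_0$ and at each $x_{1^{(i)}}$, and the objective is $\frac1{n^2}\sum_{i,j=1}^n\|x_{1^{(i)}}-\beta g(x_{1^{(i)}},\xi_{1^{(i)}}^{(j)})-x_*\|^2$. **Matrices of the dual problem.** Let $e_k$ be the $k$-th standard basis vector of $\mathbb{R}^{1+n+n^2}$. For $i,j\in\{1,\dots,n\}$ set $$\bar x_0=e_1,\quad \bar g_0^{(i)}=e_{1+i},\quad \bar g_{1^{(i)}}^{(j)}=e_{1+n+(i-1)n+j},\quad \bar x_{1^{(i)}}=\bar x_0-\alpha\bar g_0^{(i)},\quad \bar x_*=\mathbf 0,$$ $$\nabla\bar f_0=\frac1n\sum_{t=1}^n\bar g_0^{(t)},\quad \nabla\bar f_{1^{(i)}}=\frac1n\sum_{t=1}^n\bar g_{1^{(i)}}^{(t)},\quad \nabla\bar f_*=\mathbf 0.$$ Define the $(1+n+n^2)\times(1+n+n^2)$ matrices $$\bar A_R=\bar x_0\bar x_0^\top,\qquad \bar A_0^{\mathrm{var}}=\frac1n\sum_{i=1}^n(\bar g_0^{(i)}-\nabla\bar f_0)(\bar g_0^{(i)}-\nabla\bar f_0)^\top,$$ $$\bar A_i^{\mathrm{var}}=\frac1n\sum_{j=1}^n(\bar g_{1^{(i)}}^{(j)}-\nabla\bar f_{1^{(i)}})(\bar g_{1^{(i)}}^{(j)}-\nabla\bar f_{1^{(i)}})^\top\quad(i=1,\dots,n),$$ $$\bar C=\frac1{n^2}\sum_{i=1}^n\sum_{j=1}^n(\bar x_0-\alpha\bar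 g_0^{(i)}-\beta\bar g_{1^{(i)}}^{(j)})(\bar x_0-\alpha\bar g_0^{(i)}-\beta\bar g_{1^{(i)}}^{(j)})^\top,$$ and, for $i,j\in\Omega$ (with $m=1$), $$\bar B_{i,j}=\begin{bmatrix}\bar x_i&\bar x_j&\nabla\bar f_i&\nabla\bar f_j\end{bmatrix}\begin{bmatrix} -M & M & 1 & -M \\ M & -M & -1 & M \\ 1 & -1 & -1 & 1 \\ -M & M & 1 & -1 \end{bmatrix}\begin{bmatrix}\bar x_i&\bar x_j&\nabla\bar f_i&\nabla\bar f_j\end{bmatrix}^\top.$$ The dual problem minimizes $\tau R^2+\sum_{i=0}^n\mu_i\sigma^2$ over nonnegative $\tau,\mu_i,\lambda_{i,j}$ subject to the two constraints displayed in (ii). Here $X\succeq\mathbf 0$ means positive semidefinite. *)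

(* Defs.v *)
From HB Require Import structures.
From mathcomp Require Import all_boot all_order all_algebra.
From mathcomp Require Import all_classical all_reals all_analysis.

Set Implicit Arguments.
Unset Strict Implicit.
Unset Printing Implicit Defensive.

Import Order.TTheory GRing.Theory Num.Theory.
Import numFieldNormedType.Exports.

Local Open Scope classical_set_scope.
Local Open Scope ring_scope.

(** * The function class and the two-step performance estimation problem *)

(* The canonical norm [`|x|] of ['rV[R]_d] is the sup norm, hence a separate
   Euclidean norm. *)
Definition enorm (R : realType) (d : nat) (x : 'rV[R]_d) : R :=
  Num.sqrt (\sum_(k < d) x 0 k ^+ 2).

Definition gradient (R : realType) (d : nat) (f : 'rV[R]_d -> R)
    (x : 'rV[R]_d) : 'rV[R]_d :=
  \row_(k < d) 'D_(delta_mx 0 k) f x.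

Definition strongly_convex (R : realType) (d : nat) (m : R)
    (f : 'rV[R]_d -> R) : Prop :=
  @convex_function R 'rV[R]_d setT (fun x => f x - m / 2 * enorm x ^+ 2).

(* The class F_{1,M}.  Properness is automatic for a real-valued [f]. *)
Definition class_F1 (R : realType) (M : R) (d : nat)
    (f : 'rV[R]_d -> R) : Prop :=
  [/\ lower_semicontinuous (fun x => (f x)%:E),
      strongly_convex 1 f,
      forall x, differentiable f x &
      forall x y, enorm (gradient f x - gradient f y) <= M * enorm (x - y)].

(* [pep_xi0 i] is xi_0^(i) and [pep_xi1 i j] is xi_{1^(i)}^(j): the sample
   drawn at x_{1^(i)} may depend on i. *)
Record pep_instance (R : realType) (n : nat) : Type := PepInstance {
  pep_dim : nat;
  pep_f : 'rV[R]_pep_dim -> R;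
  pep_xstar : 'rV[R]_pep_dim;
  pep_x0 : 'rV[R]_pep_dim;
  pep_Xi : Type;
  pep_g : 'rV[R]_pep_dim -> pep_Xi -> 'rV[R]_pep_dim;
  pep_xi0 : 'I_n -> pep_Xi;
  pep_xi1 : 'I_n -> 'I_n -> pep_Xi }.

Definition unbiased_bounded_variance (R : realType) (n d : nat) (sigma : R)
    (f : 'rV[R]_d -> R) (Xi : Type) (g : 'rV[R]_d -> Xi -> 'rV[R]_d)
    (xi : 'I_n -> Xi) (x : 'rV[R]_d) : Prop :=
  n%:R^-1 *: (\sum_(i < n) g x (xi i)) = gradient f x /\
  n%:R^-1 * (\sum_(i < n) enorm (g x (xi i) - gradient f x) ^+ 2)
    <= sigma ^+ 2.

Definition pep_x1 (R : realType) (n : nat) (alpha : R) (I : pep_instance R n)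
    (i : 'I_n) : 'rV[R]_(pep_dim I) :=
  pep_x0 I - alpha *: pep_g (pep_x0 I) (pep_xi0 I i).

Definition pep_x2 (R : realType) (n : nat) (alpha beta : R)
    (I : pep_instance R n) (i j : 'I_n) : 'rV[R]_(pep_dim I) :=
  pep_x1 alpha I i - beta *: pep_g (pep_x1 alpha I i) (pep_xi1 I i j).

Definition pep_feasible (R : realType) (M : R) (n : nat)
    (alpha radius sigma : R) (I : pep_instance R n) : Prop :=
  [/\ class_F1 M (pep_f (p := I)),
      gradient (pep_f (p := I)) (pep_xstar I) = 0,
      enorm (pep_x0 I - pep_xstar I) ^+ 2 <= radius ^+ 2,
      unbiased_bounded_variance sigma (pep_f (p := I)) (pep_g (p := I))
        (pep_xi0 I) (pep_x0 I) &
      forall i : 'I_n,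
        unbiased_bounded_variance sigma (pep_f (p := I)) (pep_g (p := I))
          (pep_xi1 I i) (pep_x1 alpha I i)].

Definition pep_objective (R : realType) (n : nat) (alpha beta : R)
    (I : pep_instance R n) : R :=
  (n%:R ^+ 2)^-1 *
  \sum_(i < n) \sum_(j < n) enorm (pep_x2 alpha beta I i j - pep_xstar I) ^+ 2.

Definition pep_value (R : realType) (M : R) (n : nat)
    (alpha beta radius sigma : R) : \bar R :=
  ereal_sup [set (pep_objective alpha beta I)%:E
            | I in @pep_feasible R M n alpha radius sigma].

(** * The schedule *)

Definition is_alpha_star (R : realType) (M : R) (n : nat) (v alpha : R) : Prop :=
  let N : R := n%:R in
  M^-1 <= alpha < 1 /\
  0 = (M - 1) * M * N * alpha ^+ 3 - (M + 1) * (M - 2) * N * alpha ^+ 2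
      - (4 * N + (M - 1) * (N - 1) * v) * alpha + 2 * N.

Definition is_beta_star (R : realType) (M : R) (n : nat)
    (v alpha beta : R) : Prop :=
  let N : R := n%:R in
  alpha / M < beta < (M + 1) / (2 * M) /\
  0 = M * N * ((M - 1) ^+ 2 * N + (M + 1) ^+ 2 * (N - 1) * v)
        * ((M - 1) * alpha + (M + 1)) * beta ^+ 2
      + 2 * M * (2 * (M - 1) * M * N * (- N + (N - 1) * v) * alpha ^+ 2
                 + (1 + M) * (- N + (N - 1) * v)
                     * ((3 - M) * N + (M - 1) * (N - 1) * v) * alpha
                 + N * (N - (M - 4) * M * N
                        - (1 + M) * (3 + M) * (N - 1) * v)) * beta
      + (- (2 * M * (M ^+ 2 - 1) * N * (- N + (N - 1) * v) * alpha ^+ 2)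
         + (2 * (2 + M + 2 * M ^+ 2 - M ^+ 3) * N ^+ 2
            + (M - 3) * (1 + M) ^+ 2 * (N - 1) * N * v
            + (1 - M) * (1 + M) ^+ 2 * (N - 1) ^+ 2 * v ^+ 2) * alpha
         + 2 * (1 + M) ^+ 2 * N * (- N + (N - 1) * v)).

(** * The index set Omega *)

(* [Pt0], [Pt1 i] and [PtStar] stand for 0, 1^(i) and the star. *)
Inductive Omega (n : nat) : Type := Pt0 | Pt1 of 'I_n | PtStar.
Arguments Pt0 {n}.
Arguments PtStar {n}.

Definition Omega_code (n : nat) (w : Omega n) : option (option 'I_n) :=
  match w with
  | Pt0 => Some None
  | Pt1 i => Some (Some i)
  | PtStar => None
  end.

Definition Omega_decode (n : nat) (c : option (option 'I_n)) : Omega n :=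
  match c with
  | Some None => Pt0
  | Some (Some i) => Pt1 i
  | None => PtStar
  end.

Lemma Omega_codeK (n : nat) : cancel (@Omega_code n) (@Omega_decode n).
Proof. by case. Qed.

HB.instance Definition _ (n : nat) :=
  Finite.copy (Omega n) (can_type (@Omega_codeK n)).

(** * The multipliers *)

(* [lambda_1s], [lambda_s1], [lambda_s0], [lambda_01], [lambda_10] are the
   common values of lambda_{i,*}, lambda_{*,i}, lambda_{*,0}, lambda_{0,i},
   lambda_{i,0} for i outside {0,*}. *)
Definition lambda_1s (R : realType) (M : R) (n : nat) (alpha beta : R) : R :=
  (alpha + beta - alpha * beta) / (n%:R * (1 + M - alpha + M * alpha)).

Definition lambda_s1 (R : realType) (M : R) (n : nat) (alpha beta : R) : R :=
  (M * beta + alpha * (-1 + M * beta))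
  / (M * n%:R * (1 + M - alpha + M * alpha)).

Definition lambda_s0 (R : realType) (M : R) (n : nat) (alpha beta : R) : R :=
  n%:R * (lambda_1s M n alpha beta - lambda_s1 M n alpha beta).

Definition lambda_01 (R : realType) (M : R) (n : nat) (v alpha beta : R) : R :=
  let l1s := lambda_1s M n alpha beta in
  let ls1 := lambda_s1 M n alpha beta in
  (n%:R ^+ 2 * (l1s + M * ls1) ^+ 2 - n%:R * (l1s + ls1))
    / (2 * (n%:R - n%:R * v + v)) + (l1s - ls1) / 2.

Definition lambda_10 (R : realType) (M : R) (n : nat) (v alpha beta : R) : R :=
  let l1s := lambda_1s M n alpha beta in
  let ls1 := lambda_s1 M n alpha beta in
  (n%:R ^+ 2 * (l1s + M * ls1) ^+ 2 - n%:R * (l1s + ls1))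
    / (2 * (n%:R - n%:R * v + v)) - (l1s - ls1) / 2.

(* The values on the diagonal are never used. *)
Definition lambda (R : realType) (M : R) (n : nat) (v alpha beta : R)
    (i j : Omega n) : R :=
  match i, j with
  | Pt1 _, PtStar => lambda_1s M n alpha beta
  | PtStar, Pt1 _ => lambda_s1 M n alpha beta
  | Pt0, PtStar => 0
  | PtStar, Pt0 => lambda_s0 M n alpha beta
  | Pt0, Pt1 _ => lambda_01 M n v alpha beta
  | Pt1 _, Pt0 => lambda_10 M n v alpha beta
  | Pt1 _, Pt1 _ => 0
  | Pt0, Pt0 | PtStar, PtStar => 0
  end.

Definition tau (R : realType) (M : R) (n : nat) (v alpha beta : R) : R :=
  let lam := @lambda R M n v alpha beta in
  1 - M * (lam Pt0 PtStar + lam PtStar Pt0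
           + \sum_(i < n) lam (Pt1 i) PtStar
           + \sum_(i < n) lam PtStar (Pt1 i)).

(* Division by zero being total, the convention mu_0 = +oo for n > 1 and v = 0
   has to be spelled out. *)
Definition mu0 (R : realType) (M : R) (n : nat) (v alpha beta : R) : \bar R :=
  let N : R := n%:R in
  let l01 := lambda_01 M n v alpha beta in
  let l10 := lambda_10 M n v alpha beta in
  let lam := @lambda R M n v alpha beta in
  if n == 1%N then 0%E
  else if v == 0 then +oo%E
  else (Num.max 0
          ((N ^+ 2 - (N - 1) ^+ 2 * v ^+ 2) / ((N - 1) * v) * (l01 + l10)
           + N * (l01 + l10) - 2 * alpha * N * (l01 + M * l10)
           + (lam Pt0 PtStar + lam PtStar Pt0)))%:E.

(* mu_i for 1 <= i <= n *)
Definition mu1 (R : realType) (M : R) (n : nat) (v alpha beta : R)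
    (i : 'I_n) : R :=
  let N : R := n%:R in
  if n == 1%N then 0
  else Num.max 0
         ((1 - (N - 1) * v / N)
            * (lambda_01 M n v alpha beta + lambda_10 M n v alpha beta)
          + (lambda_s1 M n alpha beta + lambda_1s M n alpha beta)).

(** * The matrices of the dual problem *)

Definition gram_dim (n : nat) : nat := (1 + n + n ^ 2)%N.

(* [ebase n k] is the standard basis vector with 0-based index [k]. *)
Definition ebase (R : realType) (n k : nat) : 'cV[R]_(gram_dim n) :=
  \col_(l < gram_dim n) ((l : nat) == k)%:R.

Definition gbar0 (R : realType) (n : nat) (i : 'I_n) : 'cV[R]_(gram_dim n) :=
  ebase R n (1 + i).

Definition gbar1 (R : realType) (n : nat) (i j : 'I_n) :
    'cV[R]_(gram_dim n) :=
  ebase R n (1 + n + i * n + j).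

Definition xbar (R : realType) (n : nat) (alpha : R) (w : Omega n) :
    'cV[R]_(gram_dim n) :=
  match w with
  | Pt0 => ebase R n 0
  | Pt1 i => ebase R n 0 - alpha *: gbar0 R i
  | PtStar => 0
  end.

Definition gradbar (R : realType) (n : nat) (w : Omega n) :
    'cV[R]_(gram_dim n) :=
  match w with
  | Pt0 => n%:R^-1 *: \sum_(t < n) gbar0 R t
  | Pt1 i => n%:R^-1 *: \sum_(t < n) gbar1 R i t
  | PtStar => 0
  end.

Definition Abar_R (R : realType) (n : nat) : 'M[R]_(gram_dim n) :=
  ebase R n 0 *m (ebase R n 0)^T.

Definition Abar_var0 (R : realType) (n : nat) : 'M[R]_(gram_dim n) :=
  n%:R^-1 *: \sum_(i < n)
    (gbar0 R i - gradbar R Pt0) *m (gbar0 R i - gradbar R Pt0)^T.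

Definition Abar_var1 (R : realType) (n : nat) (i : 'I_n) :
    'M[R]_(gram_dim n) :=
  n%:R^-1 *: \sum_(j < n)
    (gbar1 R i j - gradbar R (Pt1 i)) *m (gbar1 R i j - gradbar R (Pt1 i))^T.

Definition Cbar (R : realType) (n : nat) (alpha beta : R) :
    'M[R]_(gram_dim n) :=
  (n%:R ^+ 2)^-1 *: \sum_(i < n) \sum_(j < n)
    (ebase R n 0 - alpha *: gbar0 R i - beta *: gbar1 R i j)
    *m (ebase R n 0 - alpha *: gbar0 R i - beta *: gbar1 R i j)^T.

Definition interp_mx (R : realType) (M : R) : 'M[R]_4 :=
  \matrix_(k < 4, l < 4)
    nth 0 (nth [::] [:: [:: - M;   M;   1; - M];
                        [::   M; - M; - 1;   M];
                        [::   1; - 1; - 1;   1];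
                        [:: - M;   M;   1; - 1]] k) l.

Definition interp_vectors (R : realType) (n : nat) (alpha : R)
    (i j : Omega n) : 'M[R]_(gram_dim n, 4) :=
  \matrix_(k < gram_dim n, l < 4)
    (nth 0 [:: xbar alpha i; xbar alpha j; gradbar R i; gradbar R j] l) k 0.

Definition Bbar (R : realType) (M : R) (n : nat) (alpha : R)
    (i j : Omega n) : 'M[R]_(gram_dim n) :=
  interp_vectors alpha i j *m interp_mx M *m (interp_vectors alpha i j)^T.

(** * The semidefinite constraint *)

Definition qform (R : realType) (N : nat) (X : 'M[R]_N) (u : 'cV[R]_N) : R :=
  (u^T *m X *m u) 0 0.

Definition psdmx (R : realType) (N : nat) (X : 'M[R]_N) : Prop :=
  X^T = X /\ forall u : 'cV[R]_N, 0 <= qform X u.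

(* The left-hand side of the constraint, with [m0] as multiplier of
   [Abar_var0]. *)
Definition dual_slack (R : realType) (M : R) (n : nat) (v alpha beta m0 : R) :
    'M[R]_(gram_dim n) :=
  tau M n v alpha beta *: Abar_R R n
  + (m0 *: Abar_var0 R n
     + \sum_(i < n) mu1 M v alpha beta i *: Abar_var1 R i)
  - \sum_(p : Omega n * Omega n | p.1 != p.2)
      lambda M v alpha beta p.1 p.2 *: Bbar M alpha p.1 p.2
  - Cbar n alpha beta.

(* When [mu0] is infinite the constraint is read in the extended sense; in
   [\bar R], [+oo * 0 = 0] and [+oo * x = +oo] for [0 < x]. *)
Definition dual_psd (R : realType) (M : R) (n : nat) (v alpha beta : R) : Prop :=
  match mu0 M n v alpha beta with
  | r%:E%E => psdmx (dual_slack M n v alpha beta r)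
  | m0 => forall u : 'cV[R]_(gram_dim n),
      (0 <= m0 * (qform (Abar_var0 R n) u)%:E
            + (qform (dual_slack M n v alpha beta 0) u)%:E)%E
  end.

Definition dual_bound (R : realType) (M : R) (n : nat)
    (v alpha beta radius sigma : R) : \bar R :=
  ((tau M n v alpha beta * radius ^+ 2)%:E
   + (mu0 M n v alpha beta * (sigma ^+ 2)%:E
      + (\sum_(i < n) mu1 M v alpha beta i * sigma ^+ 2)%R%:E))%E.

(* Main.v *)
(* Put k = (n - 1) v / n.  The two equations of the schedule depend on n and v
   only through k, and together they force two relations between the
   multipliers which diagonalize the dual slack.  For scalar data x, g_i, G_ij,
   with means gb of the g_i and H_i of the G_ij, deviations w_i = g_i - gb, and
   P = n (lambda_{0,1} + lambda_{1,0}) > 0, the slack is the mean over i of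
     k P gb^2 + [k P H_i^2 + (mu_0 + F) w_i^2 + 2 P w_i H_i]
     + (n mu_i - beta^2) (1/n) sum_j (G_ij - H_i)^2,
   with F = M alpha^2 (n lambda_{1,*} + n lambda_{*,1} + P) - alpha^2, the terms
   linear in w_i averaging out.  Here k (mu_0 + F) >= P makes the bracket
   nonnegative, and n mu_i >= beta^2.  If n = 1 all deviations vanish; if n > 1
   and v = 0, then mu_0 = +oo and only data with all w_i = 0 matter.
   The bound on the PEP follows by applying this to every coordinate and adding
   the interpolation inequalities of F_{1,M}, in which the function values
   cancel because lambda is a circulation. *)
Require Import Defs.
From mathcomp Require Import all_boot all_order all_algebra.
From mathcomp Require Import all_classical all_reals all_analysis.
From mathcomp Require Import ring lra.

Set Implicit Arguments.
Unset Strict Implicit.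
Unset Printing Implicit Defensive.

Import Order.TTheory GRing.Theory Num.Theory.
Import numFieldNormedType.Exports.

Local Open Scope ring_scope.

(** * The equations of the schedule *)

Definition schedule_cubic (R : realFieldType) (M k al : R) : R :=
  (M - 1) * M * al ^+ 3 - (M + 1) * (M - 2) * al ^+ 2 - (4 + (M - 1) * k) * al + 2.

Definition schedule_quadratic (R : realFieldType) (M k al be : R) : R :=
  M * ((M - 1) ^+ 2 + (M + 1) ^+ 2 * k) * ((M - 1) * al + (M + 1)) * be ^+ 2
  + 2 * M * (2 * (M - 1) * M * (- 1 + k) * al ^+ 2
             + (1 + M) * (- 1 + k) * ((3 - M) + (M - 1) * k) * al
             + (1 - (M - 4) * M - (1 + M) * (3 + M) * k)) * be
  + (- (2 * M * (M ^+ 2 - 1) * (- 1 + k) * al ^+ 2)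
     + (2 * (2 + M + 2 * M ^+ 2 - M ^+ 3) + (M - 3) * (1 + M) ^+ 2 * k
        + (1 - M) * (1 + M) ^+ 2 * k ^+ 2) * al
     + 2 * (1 + M) ^+ 2 * (- 1 + k)).

(** The factors [2 - al * (M + 1)] and [k + (M * al - 1) * (1 - al)] isolated here are the
    coefficients of [L] in [schedule_stationary]. *)
Lemma schedule_cubicE (R : realFieldType) (M k al : R) :
  schedule_cubic M k al
  = (1 - al) * (2 - al * (M + 1))
    - al * (M - 1) * (k + (M * al - 1) * (1 - al)).
Proof. rewrite /schedule_cubic; ring. Qed.

(** If [al * (M + 1) >= 2], then [M * al > 1], so in the factored cubic the first product is
    nonpositive while the subtracted one is positive. *)
Lemma schedule_alpha_lt (R : realFieldType) (M k al : R) :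
  1 < M -> 0 <= k -> M^-1 <= al -> al < 1 -> schedule_cubic M k al = 0 ->
  al * (M + 1) < 2.
Proof.
move=> M1 k0 alM al1; rewrite schedule_cubicE => E.
have M0 : 0 < M by lra.
have Mal : 1 <= M * al by rewrite -(mulfV (lt0r_neq0 M0)) ler_pM2l.
have a0 : 0 < al by apply: lt_le_trans alM; rewrite invr_gt0.
rewrite ltNge; apply/negP => le2.
have : 0 < al * (M - 1) * (k + (M * al - 1) * (1 - al)).
  have Mal1 : 0 < M * al - 1 by lra.
  apply: mulr_gt0; first by apply: mulr_gt0; lra.
  by apply: ltr_wpDl => //; apply: mulr_gt0; lra.
have : 0 <= (1 - al) * (al * (M + 1) - 2) by apply: mulr_ge0; lra.
lra.
Qed.

(* These two equations become [cert_pivot] and [cert_cross] below.  Writing them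
   as [E = 0] and [T = 0], the cubic gives [(1 - al) T = al (M - 1) E] and the
   quadratic is a combination of [E], [T] and the cubic, so that a multiple of
   [E] vanishes; the factor is positive because [al < 2 / (M + 1)]. *)
Lemma schedule_stationary (R : realFieldType) (M k al be : R)
  (D := 1 + M - al + M * al) (L := M * D * be ^+ 2 - (M - 1) * al - 2 * M * be) :
  1 < M -> 0 <= k -> M^-1 <= al -> al < 1 -> schedule_cubic M k al = 0 ->
  schedule_quadratic M k al be = 0 ->
  L * (k + (M * al - 1) * (1 - al)) = (1 - k) * al * (1 - al) * (M + 1 - 2 * M * be)
  /\ L * (2 - al * (M + 1)) = (1 - k) * al ^+ 2 * (M - 1) * (M + 1 - 2 * M * be).
Proof.
move=> M1 k0 alM al1 cub quad.
have al2 := schedule_alpha_lt M1 k0 alM al1 cub.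
have M0 : 0 < M by lra.
have a0 : 0 < al by apply: lt_le_trans alM; rewrite invr_gt0.
pose E := L * (k + (M * al - 1) * (1 - al))
  - (1 - k) * al * (1 - al) * (M + 1 - 2 * M * be).
pose T := L * (2 - al * (M + 1)) - (1 - k) * al ^+ 2 * (M - 1) * (M + 1 - 2 * M * be).
pose Y := M ^+ 2 + 1 - M * (M + 1) * al.
have quadE : schedule_quadratic M k al be =
    (M + 1) ^+ 2 * E + Y * T
    - (M + 1) * (1 - k) * (M + 1 - 2 * M * be) * schedule_cubic M k al.
  rewrite /schedule_quadratic /schedule_cubic /E /T /Y /L /D; ring.
have TE : (1 - al) * T - al * (M - 1) * E = L * schedule_cubic M k al.
  rewrite schedule_cubicE /E /T /L; ring.
move: quadE TE; rewrite cub quad !mulr0 subr0 => quadE TE.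
have XE : ((M + 1) ^+ 2 * (1 - al) + al * (M - 1) * Y) * E = 0.
  have -> : ((M + 1) ^+ 2 * (1 - al) + al * (M - 1) * Y) * E
     = (1 - al) * ((M + 1) ^+ 2 * E + Y * T) - Y * ((1 - al) * T - al * (M - 1) * E).
    ring.
  by rewrite -quadE TE; ring.
have X0 : 0 < (M + 1) ^+ 2 * (1 - al) + al * (M - 1) * Y.
  have -> : (M + 1) ^+ 2 * (1 - al) + al * (M - 1) * Y =
    al * (M - 1) * M * (2 - al * (M + 1)) + (M + 1) ^+ 2 * (1 - al)
    + al * (M - 1) * (M - 1) ^+ 2 by rewrite /Y; ring.
  apply: ltr_wpDr.
    by rewrite mulr_ge0 ?sqr_ge0 // mulr_ge0 //; lra.
  apply: ltr_wpDl.
    by apply: mulr_ge0; [apply: mulr_ge0; [apply: mulr_ge0|]|]; lra.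
  by rewrite mulr_gt0 ?exprn_gt0 //; lra.
have E0 : E = 0 by move/eqP: XE; rewrite mulf_eq0 (gt_eqF X0) => /eqP.
have T0 : T = 0.
  move/eqP: TE; rewrite E0 mulr0 subr0 mulf_eq0 => /orP[/eqP|/eqP //]; lra.
by split; apply/eqP; rewrite -subr_eq0; apply/eqP.
Qed.

(* [a], [b], [p], [q] are [n] times the multipliers lambda_{1,*}, lambda_{*,1},
   lambda_{0,1}, lambda_{1,0}, and [k] is [(n - 1) v / n]. *)
Record dual_certificate (R : realFieldType) (M k al be a b p q : R) : Prop :=
  DualCertificate {
    cert_b_ge0 : 0 <= b;
    cert_ba : b <= a;
    cert_q_ge0 : 0 <= q;
    cert_pq_gt0 : 0 < p + q;
    cert_a_le : 2 * M * a <= 1;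
    cert_be : a + M * b = be;
    cert_x0g0 : al * (1 - M * (a + b)) = M * (a - b);
    cert_pq : (1 - k) * (p + q) = be ^+ 2 - (a + b);
    cert_pBq : p - q = a - b;
    cert_cross : al * (q + M * p) = p + q;
    cert_pivot : M * al ^+ 2 * (a + b + (p + q)) - al ^+ 2 + (a - b) + (p + q)
                 - 2 * al * (p + M * q) = k * (p + q) }.

(** Here [P] is [p + q] and [M * P = L / ((1 - k) * D)], so the two relations of
    [schedule_stationary] become values of [M * P] times explicit factors. These yield the signs of
    [P] and [q] as well as [cert_cross] and [cert_pivot]. *)
Lemma schedule_certificate (R : realFieldType) (M k al be : R)
  (D := 1 + M - al + M * al)
  (a := (al + be - al * be) / D) (b := (M * be + al * (-1 + M * be)) / (M * D))
  (P := ((a + M * b) ^+ 2 - (a + b)) / (1 - k)) :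
  1 < M -> 0 <= k -> k < 1 -> M^-1 <= al -> al < 1 ->
  al / M < be -> be < (M + 1) / (2 * M) ->
  schedule_cubic M k al = 0 -> schedule_quadratic M k al be = 0 ->
  dual_certificate M k al be a b (P / 2 + (a - b) / 2) (P / 2 - (a - b) / 2).
Proof.
move=> M1 k0 k1 alM al1 be_lb be_ub cub quad.
pose L := M * D * be ^+ 2 - (M - 1) * al - 2 * M * be.
have [pivot cross] :
    L * (k + (M * al - 1) * (1 - al))
      = (1 - k) * al * (1 - al) * (M + 1 - 2 * M * be)
    /\ L * (2 - al * (M + 1)) = (1 - k) * al ^+ 2 * (M - 1) * (M + 1 - 2 * M * be)
  := schedule_stationary M1 k0 alM al1 cub quad.
have al2 := schedule_alpha_lt M1 k0 alM al1 cub.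
have M0 : 0 < M by lra.
have a0 : 0 < al by apply: lt_le_trans alM; rewrite invr_gt0.
have Mal : 1 <= M * al by rewrite -(mulfV (lt0r_neq0 M0)) ler_pM2l.
have Mal0 : 0 < (M - 1) * al by apply: mulr_gt0; lra.
have D0 : 0 < D by rewrite /D; lra.
have Mbe : al < M * be by move: be_lb; rewrite ltr_pdivrMr // mulrC.
have be0 : 0 < be by apply: lt_trans be_lb; rewrite divr_gt0.
have s0 : 0 < M + 1 - 2 * M * be.
  by move: be_ub; rewrite ltr_pdivlMr ?mulr_gt0 // subr_gt0 mulrC.
have Dn0 := lt0r_neq0 D0; have Mn0 := lt0r_neq0 M0.
have k1n0 : 1 - k != 0 by apply: lt0r_neq0; rewrite subr_gt0.
(* This is [1 - M * (a + b)], and [M * (a - b)] is [al * s]; the upper bound on [be] makes it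
   positive. *)
pose s := (M + 1 - 2 * M * be) / D.
have beE : a + M * b = be by rewrite /a /b /D; field; rewrite -/D Mn0 Dn0.
have aBb : M * (a - b) = al * s by rewrite /a /b /s /D; field; rewrite -/D Mn0 Dn0.
have aDb : 1 - M * (a + b) = s.
  by rewrite /a /b /s /D; field; rewrite -/D Mn0 Dn0.
have s_gt0 : 0 < s by rewrite divr_gt0.
have PE : (1 - k) * P = be ^+ 2 - (a + b) by rewrite /P beE; field.
have PLE : M * P = L / ((1 - k) * D).
  have sDE : D * s = M + 1 - 2 * M * be by rewrite /s; field.
  apply: (mulfI (mulf_neq0 k1n0 Dn0)); rewrite [RHS]mulrC divfK ?mulf_neq0 //.
  rewrite (_ : _ * (M * P) = M * D * ((1 - k) * P)); last by ring.
  rewrite PE (_ : M * D * (be ^+ 2 - (a + b)) =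
    M * D * be ^+ 2 - D + D * (1 - M * (a + b))); last by ring.
  by rewrite aDb sDE /L /D; ring.
have pivotP : M * P * (k + (M * al - 1) * (1 - al)) = al * (1 - al) * s.
  have -> : M * P * (k + (M * al - 1) * (1 - al)) =
      L * (k + (M * al - 1) * (1 - al)) / ((1 - k) * D).
    by rewrite PLE; field; rewrite k1n0 Dn0.
  by rewrite pivot /s; field; rewrite Dn0.
have crossP : M * P * (2 - al * (M + 1)) = al ^+ 2 * (M - 1) * s.
  have -> : M * P * (2 - al * (M + 1)) = L * (2 - al * (M + 1)) / ((1 - k) * D).
    by rewrite PLE; field; rewrite k1n0 Dn0.
  by rewrite cross /s; field; rewrite Dn0.
have al2' : 0 < 2 - al * (M + 1) by rewrite subr_gt0.
have P0 : 0 < P.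
  have : 0 < M * P * (2 - al * (M + 1)).
    by rewrite crossP mulr_gt0 // mulr_gt0 ?exprn_gt0 //; lra.
  by rewrite (pmulr_lgt0 _ al2') (pmulr_rgt0 _ M0).
(* This amounts to [q >= 0] and rests on [al >= 1 / M]. *)
have Pab : a - b <= P.
  have : 0 <= M * (P - (a - b)) * (2 - al * (M + 1)).
    have -> : M * (P - (a - b)) * (2 - al * (M + 1)) = al * s * (2 * (M * al - 1)).
      by rewrite (mulrBr M) aBb mulrBl crossP; ring.
    by apply: mulr_ge0; [apply: mulr_ge0; exact: ltW|lra].
  by rewrite (pmulr_lge0 _ al2') (pmulr_rge0 _ M0) subr_ge0.
split => //.
- apply: divr_ge0; last by apply: mulr_ge0; exact: ltW.
  rewrite mulrDr; have : 0 < al * (M * be) by rewrite mulr_gt0 // mulr_gt0.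
  by lra.
- rewrite -subr_ge0 -(pmulr_rge0 _ M0) aBb; apply: mulr_ge0; exact: ltW.
- by lra.
- by lra.
- have -> : 2 * M * a = (M * (a - b) + 1 - (1 - M * (a + b))) by ring.
  rewrite aBb aDb.
  have : 0 <= (1 - al) * s by apply: mulr_ge0; [lra|exact: ltW].
  by lra.
- by rewrite aDb aBb.
- by rewrite (_ : P / 2 + (a - b) / 2 + (P / 2 - (a - b) / 2) = P) //; field.
- by field.
- apply: (mulfI Mn0); apply/eqP; rewrite -subr_eq0; apply/eqP.
  transitivity ((al * (M - 1) * (M * (a - b)) - M * P * (2 - al * (M + 1))) / 2).
    by field.
  by rewrite aBb crossP; ring.
- apply: (mulfI Mn0); apply/eqP; rewrite -subr_eq0; apply/eqP.
  transitivity (- M * al ^+ 2 * (1 - M * (a + b))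
     + (1 + al * (M - 1)) * (M * (a - b))
     + M * P * (M * al ^+ 2 + 1 - al * (M + 1) - k)).
    by field.
  rewrite aDb aBb.
  transitivity (al * (1 - al) * s - M * P * (k + (M * al - 1) * (1 - al))).
    by ring.
  by rewrite pivotP subrr.
Qed.

(** * The dual slack on scalar data *)

Definition mean (R : realType) (n : nat) (F : 'I_n -> R) : R :=
  n%:R^-1 * \sum_(i < n) F i.

Lemma mean_dev (R : realType) (n : nat) (F : 'I_n -> R) :
  (0 < n)%N -> \sum_(i < n) (F i - mean F) = 0.
Proof.
move=> n0; rewrite sumrB sumr_const card_ord -mulr_natl mulVKf ?subrr //.
by rewrite pnatr_eq0 -lt0n.
Qed.

(** Splitting into mean and variance: the cross term is linear in the deviations and sums to
    zero. *)
Lemma mean_sqr_affine (R : realType) (n : nat) (F : 'I_n -> R) (c d : R) : (0 < n)%N ->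
  \sum_(i < n) (c - d * F i) ^+ 2
  = n%:R * (c - d * mean F) ^+ 2 + d ^+ 2 * \sum_(i < n) (F i - mean F) ^+ 2.
Proof.
move=> n0; have dev0 := mean_dev F n0.
transitivity (\sum_(i < n) ((c - d * mean F) ^+ 2 + d ^+ 2 * (F i - mean F) ^+ 2
   + (- 2 * d * (c - d * mean F)) * (F i - mean F))).
  by apply: eq_bigr => i _; ring.
rewrite !big_split /= sumr_const card_ord -!mulr_sumr dev0 mulr0 addr0.
by rewrite mulr_natl.
Qed.

Lemma big_Omega (R : realType) (n : nat) (F : Omega n -> R) :
  \sum_w F w = F Pt0 + F PtStar + \sum_(i < n) F (Pt1 i).
Proof.
rewrite (bigD1 Pt0) //= (bigD1 PtStar) //= addrA; congr (_ + _).
rewrite (reindex_omap (@Pt1 n) (fun w => if w is Pt1 i then Some i else None)).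
  by apply: eq_bigl => i /=; rewrite eqxx.
by case.
Qed.

(** The quadratic form of [interp_mx M] at [(xi, xj, gi, gj)]; see [qform_Bbar]. *)
Definition interp_form (R : realFieldType) (M xi xj gi gj : R) : R :=
  - M * (xi - xj) ^+ 2 - (gi - gj) ^+ 2 + 2 * (xi - xj) * (gi - M * gj).

Definition sample_x (R : realType) (n : nat) (alpha x : R) (g : 'I_n -> R)
    (w : Omega n) : R :=
  match w with Pt0 => x | Pt1 i => x - alpha * g i | PtStar => 0 end.

Definition sample_grad (R : realType) (n : nat) (g : 'I_n -> R)
    (G : 'I_n -> 'I_n -> R) (w : Omega n) : R :=
  match w with Pt0 => mean g | Pt1 i => mean (G i) | PtStar => 0 end.

(** The quadratic form of [dual_slack] in free scalars. They are read as pairings with a test vector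
    for the semidefinite constraint, and as one coordinate of [x0 - xstar] and of the stochastic
    gradients for the performance bound. *)
Definition slack_form (R : realType) (M : R) (n : nat) (v alpha beta m0 x : R)
    (g : 'I_n -> R) (G : 'I_n -> 'I_n -> R) : R :=
  tau M n v alpha beta * x ^+ 2
  + (m0 * mean (fun i => (g i - mean g) ^+ 2)
     + \sum_(i < n) mu1 M v alpha beta i
         * mean (fun j => (G i j - mean (G i)) ^+ 2))
  - \sum_(p : Omega n * Omega n | p.1 != p.2)
      lambda M v alpha beta p.1 p.2
      * interp_form M (sample_x alpha x g p.1) (sample_x alpha x g p.2)
          (sample_grad g G p.1) (sample_grad g G p.2)
  - (n%:R ^+ 2)^-1
    * \sum_(i < n) \sum_(j < n) (x - alpha * g i - beta * G i j) ^+ 2.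

Lemma sum_lambda (R : realType) (M : R) (n : nat) (v alpha beta : R)
    (F : Omega n -> Omega n -> R) : (forall w, F w w = 0) ->
  \sum_(p : Omega n * Omega n | p.1 != p.2)
      lambda M v alpha beta p.1 p.2 * F p.1 p.2
  = lambda_s0 M n alpha beta * F PtStar Pt0
    + \sum_(i < n) (lambda_1s M n alpha beta * F (Pt1 i) PtStar
       + lambda_s1 M n alpha beta * F PtStar (Pt1 i)
       + lambda_01 M n v alpha beta * F Pt0 (Pt1 i)
       + lambda_10 M n v alpha beta * F (Pt1 i) Pt0).
Proof.
move=> F0.
transitivity (\sum_(p : Omega n * Omega n) lambda M v alpha beta p.1 p.2 * F p.1 p.2).
  rewrite big_mkcond; apply: eq_bigr => -[i j] _ /=.
  by case: eqP => //= ->; rewrite F0 mulr0.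
rewrite -(pair_bigA _ (fun i j => lambda M v alpha beta i j * F i j)) /=.
rewrite big_Omega !big_Omega /=.
under [X in _ + _ + X = _]eq_bigr => i _.
  rewrite big_Omega /= [X in _ + X]big1; last by move=> j _; rewrite mul0r.
  rewrite addr0; over.
rewrite !big_split /=; ring.
Qed.

(* With [w] and [H] the deviation of the i-th first gradient from its mean [gb]
   and the mean gradient at the i-th new point, the terms linear in [w]
   disappear on averaging. *)
Lemma certificate_identity (R : realFieldType) (M k al be a b p q : R)
    (m x gb w H : R) (y := x - al * (gb + w)) :
  dual_certificate M k al be a b p q ->
  (1 - 2 * M * a) * x ^+ 2 + m * w ^+ 2
  - (a * interp_form M y 0 H 0 + b * interp_form M 0 y 0 H
     + p * interp_form M x y gb H + q * interp_form M y x H gb)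
  - (a - b) * interp_form M 0 x 0 gb - (y - be * H) ^+ 2
  = k * (p + q) * gb ^+ 2
    + (k * (p + q) * H ^+ 2
       + (m + M * al ^+ 2 * (a + b + (p + q)) - al ^+ 2) * w ^+ 2
       + 2 * (p + q) * w * H)
    + (2 * al * (x - al * gb) * (1 - M * (a + b))
       + 2 * M * al ^+ 2 * (p + q) * gb - 2 * al * (p + M * q) * gb) * w.
Proof.
case=> _ _ _ _ _ beE e1 e2 _ e4 e5; apply/eqP; rewrite -subr_eq0.
set d := _ - _.
(* With [be] replaced by [a + M * b], the discrepancy is a combination of [cert_x0g0], [cert_pq],
   [cert_cross] and [cert_pivot]. *)
have -> : d = 2 * x * gb * (al * (1 - M * (a + b)) - M * (a - b))
  + H ^+ 2 * ((1 - k) * (p + q) - (be ^+ 2 - (a + b)))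
  + 2 * (gb + w) * H * (al * (q + M * p) - (p + q))
  + gb ^+ 2 * (M * al ^+ 2 * (a + b + (p + q)) - al ^+ 2 + (a - b) + (p + q)
                 - 2 * al * (p + M * q) - k * (p + q)).
  by rewrite /d /y /interp_form -beE; ring.
by rewrite e1 e2 e4 e5 !subrr !mulr0 !addr0.
Qed.

(** Gathers the slack into a single mean over [i]. Plain sums acquire a factor [N], which is why the
    certificate is stated for [N] times the multipliers. *)
Lemma mean_collect (R : realType) (n : nat) (N := n%:R : R)
    (c d m e l1 l2 l3 l4 : R) (mu W V Z F1 F2 F3 F4 : 'I_n -> R) : (0 < n)%N ->
  c + (m * mean W + \sum_(i < n) mu i * V i)
  - (d + \sum_(i < n) (l1 * F1 i + l2 * F2 i + l3 * F3 i + l4 * F4 i))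
  - (N ^+ 2)^-1 * \sum_(i < n) (N * Z i + e * (N * V i))
  = mean (fun i => c + m * W i - (N * l1 * F1 i + N * l2 * F2 i + N * l3 * F3 i
                                + N * l4 * F4 i) - d - Z i + (N * mu i - e) * V i).
Proof.
move=> n0; have N0 : N != 0 by rewrite pnatr_eq0 -lt0n.
have cst x : \sum_(i < n) x = N * x by rewrite sumr_const card_ord mulr_natl.
have -> : \sum_(i < n) (N * Z i + e * (N * V i))
  = N * (\sum_(i < n) Z i) + e * (N * \sum_(i < n) V i).
  by rewrite big_split /= !mulr_sumr.
rewrite /mean; under [in RHS]eq_bigr do rewrite mulrBl -!mulrA.
rewrite !big_split /= !sumrN !big_split /= -/N -!mulr_sumr !cst; field.
by rewrite N0.
Qed.

Lemma sum_mean (R : realType) (n : nat) (F : 'I_n -> R) : (0 < n)%N ->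
  \sum_(i < n) F i = n%:R * mean F.
Proof. by move=> n0; rewrite /mean mulVKf // pnatr_eq0 -lt0n. Qed.

Lemma slack_formE (R : realType) (M : R) (n : nat) (v k alpha beta m0 x : R)
    (g : 'I_n -> R) (G : 'I_n -> 'I_n -> R)
    (N := n%:R : R) (a := N * lambda_1s M n alpha beta)
    (b := N * lambda_s1 M n alpha beta)
    (p := N * lambda_01 M n v alpha beta) (q := N * lambda_10 M n v alpha beta) :
  (0 < n)%N -> dual_certificate M k alpha beta a b p q ->
  slack_form M v alpha beta m0 x g G
  = mean (fun i => k * (p + q) * mean g ^+ 2
      + (k * (p + q) * mean (G i) ^+ 2
         + (m0 + M * alpha ^+ 2 * (a + b + (p + q)) - alpha ^+ 2)
             * (g i - mean g) ^+ 2
         + 2 * (p + q) * (g i - mean g) * mean (G i))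
      + (N * mu1 M v alpha beta i - beta ^+ 2)
        * mean (fun j => (G i j - mean (G i)) ^+ 2)).
Proof.
move=> n0 cert; have N0 : N != 0 by rewrite pnatr_eq0 -lt0n.
pose y i := x - alpha * (mean g + (g i - mean g)).
have yE i : x - alpha * g i = y i by rewrite /y subrKC.
rewrite /slack_form (@sum_lambda _ _ _ _ _ _ (fun w w' => interp_form M
    (sample_x alpha x g w) (sample_x alpha x g w') (sample_grad g G w)
    (sample_grad g G w'))) /=; last first.
  by move=> w; rewrite /interp_form; ring.
have -> : \sum_(i < n) \sum_(j < n) (x - alpha * g i - beta * G i j) ^+ 2
  = \sum_(i < n) (N * (y i - beta * mean (G i)) ^+ 2
      + beta ^+ 2 * (N * mean (fun j => (G i j - mean (G i)) ^+ 2))).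
  by apply: eq_bigr => i _; rewrite mean_sqr_affine // yE -sum_mean.
rewrite mean_collect //.
(* The sums over [i] contribute [a + b] and [lambda_s0] contributes [a - b]. *)
have tauE : tau M n v alpha beta = 1 - 2 * M * a.
  rewrite /tau /= !sumr_const !card_ord /lambda_s0 -/N.
  rewrite -[lambda_1s _ _ _ _ *+ n]mulr_natl -[lambda_s1 _ _ _ _ *+ n]mulr_natl.
  by rewrite -/N /a /b; ring.
have s0E : lambda_s0 M n alpha beta = a - b by rewrite /lambda_s0 mulrBr.
rewrite tauE s0E -/N -/a -/b -/p -/q.
(* The coefficient of the deviation in [certificate_identity]. It does not depend on [i], so its
   contributions sum to zero. *)
pose c := 2 * alpha * (x - alpha * mean g) * (1 - M * (a + b))
  + 2 * M * alpha ^+ 2 * (p + q) * mean g - 2 * alpha * (p + M * q) * mean g.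
apply: (congr1 (fun s => n%:R^-1 * s)); apply: subr0_eq; rewrite -sumrB.
transitivity (\sum_(i < n) c * (g i - mean g)); last first.
  by rewrite -mulr_sumr mean_dev ?mulr0.
apply: eq_bigr => i _; rewrite !yE.
have := certificate_identity m0 x (mean g) (g i - mean g) (mean (G i)) cert.
by rewrite -/(y i) => ->; rewrite /c; ring.
Qed.

Lemma mean_ge0 (R : realType) (n : nat) (F : 'I_n -> R) :
  (forall i, 0 <= F i) -> 0 <= mean F.
Proof. by move=> F0; rewrite mulr_ge0 ?invr_ge0 ?ler0n ?sumr_ge0. Qed.

Lemma dev_n1 (R : realType) (n : nat) (F : 'I_n -> R) (i : 'I_n) :
  n = 1%N -> F i - mean F = 0.
Proof.
move=> n1; move: F i; rewrite n1 => F i.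
by rewrite /mean big_ord1 invr1 mul1r ord1 subrr.
Qed.

(** In each summand of [slack_formE] only the bracket mixing [w] and [H] has an unclear sign.
    Without first-step deviations it is a multiple of [H ^+ 2]; otherwise, multiplied by [k], it is
    completed to a square. *)
Lemma slack_form_ge0 (R : realType) (M : R) (n : nat) (v k alpha beta m0 x : R)
    (g : 'I_n -> R) (G : 'I_n -> 'I_n -> R)
    (N := n%:R : R) (a := N * lambda_1s M n alpha beta)
    (b := N * lambda_s1 M n alpha beta)
    (p := N * lambda_01 M n v alpha beta) (q := N * lambda_10 M n v alpha beta) :
  (0 < n)%N -> 0 <= k -> dual_certificate M k alpha beta a b p q ->
  (forall i : 'I_n, n = 1%N \/ beta ^+ 2 <= N * mu1 M v alpha beta i) ->
  (forall i, g i - mean g = 0) \/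
    p + q <= k * (m0 + M * alpha ^+ 2 * (a + b + (p + q)) - alpha ^+ 2) ->
  0 <= slack_form M v alpha beta m0 x g G.
Proof.
move=> n0 k0 cert Hmu Hm; rewrite (slack_formE _ _ _ _ n0 cert).
have P0 := cert_pq_gt0 cert; rewrite -/p -/q in P0.
apply: mean_ge0 => i; apply: addr_ge0; last first.
  case: (Hmu i) => [n1|le_mu]; last first.
    by rewrite mulr_ge0 ?subr_ge0 // mean_ge0 // => j; exact: sqr_ge0.
  rewrite [X in _ * X](_ : _ = 0) ?mulr0 // /mean big1 ?mulr0 // => j _.
  by rewrite -/(mean _) dev_n1 ?expr0n.
have kP0 : 0 <= k * (p + q) by rewrite mulr_ge0 // ltW.
apply: addr_ge0; first by rewrite mulr_ge0 ?sqr_ge0.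
case: Hm => [->|].
  by rewrite expr0n /= !mulr0 mul0r !addr0 mulr_ge0 ?sqr_ge0.
set m := m0 + _ - _; set w := g i - _; set H := mean (G i) => le_m.
(* For [k = 0] the hypothesis would read [p + q <= 0]. *)
have k_gt0 : 0 < k.
  by rewrite lt_neqAle k0 andbT; apply/eqP => k_eq0; move: le_m; rewrite -k_eq0; lra.
rewrite -(pmulr_rge0 _ k_gt0).
have -> : k * (k * (p + q) * H ^+ 2 + m * w ^+ 2 + 2 * (p + q) * w * H)
  = (p + q) * (k * H + w) ^+ 2 + (k * m - (p + q)) * w ^+ 2 by ring.
by rewrite addr_ge0 // mulr_ge0 ?sqr_ge0 ?subr_ge0 // ltW.
Qed.

(** * The multipliers *)

Definition variance_ratio (R : realType) (n : nat) (v : R) : R :=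
  (n%:R - 1) * v / n%:R.

(** For [n > 1] the bound on [v] says that the ratio is at most [(M - 1) / M]; for [n = 1] the ratio
    is 0 whatever [v] is. *)
Lemma variance_ratio_bounds (R : realType) (M v : R) (n : nat) :
  1 < M -> (1 <= n)%N -> 0 <= v ->
  ((1 < n)%N -> v <= ((M - 1) * n%:R) / ((n%:R - 1) * M)) ->
  0 <= variance_ratio n v < 1.
Proof.
move=> M1 n0 v0 hv; have N0 : 0 < n%:R :> R by rewrite ltr0n.
have N1 : 0 <= n%:R - 1 :> R by rewrite subr_ge0 ler1n.
apply/andP; split; first by rewrite mulr_ge0 ?mulr_ge0 ?invr_ge0 // ltW.
have [n1|n1] := leqP n 1.
  have -> : n = 1%N by apply/eqP; rewrite eqn_leq n1.
  by rewrite /variance_ratio subrr !mul0r ltr01.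
have N1' : 0 < n%:R - 1 :> R by rewrite subr_gt0 ltr1n.
have M0 : 0 < M by lra.
have := hv n1; rewrite ler_pdivlMr ?mulr_gt0 // => hv'.
rewrite ltr_pdivrMr // mul1r -(ltr_pM2r M0).
rewrite (_ : (n%:R - 1) * v * M = v * ((n%:R - 1) * M)); last by ring.
by apply: le_lt_trans hv' _; rewrite mulrC ltr_pM2l //; lra.
Qed.

Lemma multipliers_certificate (R : realType) (M v alpha beta : R) (n : nat)
    (N := n%:R : R) :
  1 < M -> (1 <= n)%N -> 0 <= v ->
  ((1 < n)%N -> v <= ((M - 1) * n%:R) / ((n%:R - 1) * M)) ->
  is_alpha_star M n v alpha -> is_beta_star M n v alpha beta ->
  dual_certificate M (variance_ratio n v) alpha beta
    (N * lambda_1s M n alpha beta) (N * lambda_s1 M n alpha beta)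
    (N * lambda_01 M n v alpha beta) (N * lambda_10 M n v alpha beta).
Proof.
move=> M1 n0 v0 hv [/andP[alM al1] eq_al] [/andP[be_lb be_ub] eq_be].
have /andP[k0 k1] := variance_ratio_bounds M1 n0 v0 hv.
have N0 : N != 0 by rewrite pnatr_eq0 -lt0n.
set k := variance_ratio n v.
(* The equations of the schedule are [N] times the cubic and [N ^+ 2] times the quadratic in [k]. *)
have cub : schedule_cubic M k alpha = 0.
  apply: (mulfI N0); rewrite mulr0 eq_al -/N /schedule_cubic /k /variance_ratio.
  by field.
have quad : schedule_quadratic M k alpha beta = 0.
  apply: (mulfI (mulf_neq0 N0 N0)); rewrite mulr0 eq_be -/N /schedule_quadratic.
  by rewrite /k /variance_ratio -/N; field.
have M0 : M != 0 by apply: lt0r_neq0; lra.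
have D0 : 1 + M - alpha + M * alpha != 0.
  apply: lt0r_neq0; have : 0 < (M - 1) * alpha.
    by rewrite mulr_gt0 ?(lt_le_trans _ alM) ?invr_gt0 //; lra.
  by lra.
have k10 : 1 - k != 0 by rewrite lt0r_neq0 // subr_gt0.
have NkE : N - N * v + v = N * (1 - k) by rewrite /k /variance_ratio -/N; field.
have cert := schedule_certificate M1 k0 k1 alM al1 be_lb be_ub cub quad.
have aE : N * lambda_1s M n alpha beta
    = (alpha + beta - alpha * beta) / (1 + M - alpha + M * alpha).
  by rewrite /lambda_1s -/N; field; rewrite D0 N0.
have bE : N * lambda_s1 M n alpha beta
    = (M * beta + alpha * (-1 + M * beta)) / (M * (1 + M - alpha + M * alpha)).
  by rewrite /lambda_s1 -/N; field; rewrite D0 M0 N0.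
rewrite -aE -bE in cert.
(* The sign [e] treats [lambda_01] ([e = 1]) and [lambda_10] ([e = -1]) together. *)
have lE e : N *
   ((N ^+ 2 * (lambda_1s M n alpha beta + M * lambda_s1 M n alpha beta) ^+ 2
      - N * (lambda_1s M n alpha beta + lambda_s1 M n alpha beta))
     / (2 * (N - N * v + v))
    + e * ((lambda_1s M n alpha beta - lambda_s1 M n alpha beta) / 2))
  = ((N * lambda_1s M n alpha beta + M * (N * lambda_s1 M n alpha beta)) ^+ 2
     - (N * lambda_1s M n alpha beta + N * lambda_s1 M n alpha beta)) / (1 - k) / 2
    + e * ((N * lambda_1s M n alpha beta - N * lambda_s1 M n alpha beta) / 2).
  by rewrite NkE; field; rewrite k10 N0.
have := lE 1; have := lE (-1).
rewrite !mul1r !mulN1r /lambda_01 /lambda_10 -/N => -> ->.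
exact: cert.
Qed.

(** By [cert_pq], [N] times the second argument of the maximum is exactly [beta ^+ 2]. *)
Lemma mu1_ge (R : realType) (M v alpha beta : R) (n : nat) (i : 'I_n)
    (k := variance_ratio n v) (N := n%:R : R) : (1 <= n)%N ->
  dual_certificate M k alpha beta
    (N * lambda_1s M n alpha beta) (N * lambda_s1 M n alpha beta)
    (N * lambda_01 M n v alpha beta) (N * lambda_10 M n v alpha beta) ->
  n = 1%N \/ beta ^+ 2 <= N * mu1 M v alpha beta i.
Proof.
move=> n0 cert; rewrite /mu1; case: eqP => [|_]; [by left|right].
have N0 : 0 < N by rewrite ltr0n.
rewrite (maxr_pMr _ _ (ltW N0)) mulr0 le_max; apply/orP; right.
have := cert_pq cert; rewrite -/N -/k /k /variance_ratio -/N => e.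
have -> : beta ^+ 2 = (1 - (N - 1) * v / N)
   * (N * lambda_01 M n v alpha beta + N * lambda_10 M n v alpha beta)
   + (N * lambda_1s M n alpha beta + N * lambda_s1 M n alpha beta).
  by rewrite e; ring.
by rewrite le_eqVlt; apply/orP; left; apply/eqP; ring.
Qed.

(** The second argument [X] of the maximum already gives equality, by [cert_pivot]; the right-hand
    side is monotone in [r] because [k >= 0]. *)
Lemma mu0_ge (R : realType) (M v alpha beta : R) (n : nat)
    (k := variance_ratio n v) (N := n%:R : R) : (1 < n)%N -> v != 0 ->
  dual_certificate M k alpha beta
    (N * lambda_1s M n alpha beta) (N * lambda_s1 M n alpha beta)
    (N * lambda_01 M n v alpha beta) (N * lambda_10 M n v alpha beta) ->
  0 <= k ->
  exists2 r : R, mu0 M n v alpha beta = r%:E%E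
    & N * lambda_01 M n v alpha beta + N * lambda_10 M n v alpha beta
      <= k * (r + M * alpha ^+ 2 *
           (N * lambda_1s M n alpha beta + N * lambda_s1 M n alpha beta
            + (N * lambda_01 M n v alpha beta + N * lambda_10 M n v alpha beta))
          - alpha ^+ 2).
Proof.
move=> n1 v0 cert k0; rewrite /mu0 gtn_eqF // (negPf v0).
eexists; first reflexivity.
have N1 : N - 1 != 0 by rewrite subr_eq0 pnatr_eq1 gtn_eqF.
have N0 : N != 0 by rewrite pnatr_eq0 -lt0n ltnW.
set X := (X in Num.max 0 X).
apply: (@le_trans _ _ (k * (X + M * alpha ^+ 2 *
           (N * lambda_1s M n alpha beta + N * lambda_s1 M n alpha beta
            + (N * lambda_01 M n v alpha beta + N * lambda_10 M n v alpha beta))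
          - alpha ^+ 2))); last first.
  by rewrite ler_wpM2l // lerD2r lerD2r le_max lexx orbT.
have pivot := cert_pivot cert; rewrite le_eqVlt; apply/orP; left; apply/eqP.
set a := N * lambda_1s _ _ _ _ in pivot *; set b := N * lambda_s1 _ _ _ _ in pivot *.
set p := N * lambda_01 _ _ _ _ _ in pivot *.
set q := N * lambda_10 _ _ _ _ _ in pivot *.
(* The factor [k] cancels the denominator [(N - 1) * v], turning the first term of [X] into
   [(1 - k ^+ 2) * (p + q)]. *)
have kX : k * X = (1 - k ^+ 2) * (p + q)
    + k * (p + q - 2 * alpha * (p + M * q) + (a - b)).
  rewrite /X /= /a /b /p /q /lambda_s0 /k /variance_ratio -/N.
  by field; rewrite N0 N1 v0.
rewrite -addrA mulrDr kX.
transitivity ((1 - k ^+ 2) * (p + q) + k * (k * (p + q))); first by ring.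
by rewrite -pivot; ring.
Qed.

Lemma lambda_ge0 (R : realType) (M k v alpha beta : R) (n : nat) (N := n%:R : R) :
  (1 <= n)%N ->
  dual_certificate M k alpha beta
    (N * lambda_1s M n alpha beta) (N * lambda_s1 M n alpha beta)
    (N * lambda_01 M n v alpha beta) (N * lambda_10 M n v alpha beta) ->
  forall i j : Omega n, 0 <= lambda M v alpha beta i j.
Proof.
move=> n0 cert; have N0 : 0 < N by rewrite ltr0n.
have [b0 ba q0 _ _ _ _ _ pBq _ _] := cert.
have s0 : 0 <= lambda_s0 M n alpha beta by rewrite /lambda_s0 mulrBr subr_ge0.
have l1s : 0 <= lambda_1s M n alpha beta.
  by rewrite -(pmulr_rge0 _ N0) (le_trans b0).
have p0 : 0 <= N * lambda_01 M n v alpha beta.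
  by rewrite -(subrK (N * lambda_10 M n v alpha beta) (_ * _)) pBq addr_ge0 ?subr_ge0.
move: b0 q0 p0; rewrite !(pmulr_rge0 _ N0) => b0 q0 p0.
by case=> [|i|] [|j|] /=.
Qed.

Lemma tau_ge0 (R : realType) (M k v alpha beta : R) (n : nat) (N := n%:R : R) :
  dual_certificate M k alpha beta
    (N * lambda_1s M n alpha beta) (N * lambda_s1 M n alpha beta)
    (N * lambda_01 M n v alpha beta) (N * lambda_10 M n v alpha beta) ->
  0 <= tau M n v alpha beta.
Proof.
move/cert_a_le; rewrite /tau /= !sumr_const !card_ord /lambda_s0 -/N.
rewrite -[lambda_1s _ _ _ _ *+ n]mulr_natl -[lambda_s1 _ _ _ _ *+ n]mulr_natl -/N.
lra.
Qed.

Lemma sum_cst (R : realType) (n : nat) (x : R) : \sum_(i < n) x = n%:R * x.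
Proof. by rewrite sumr_const card_ord mulr_natl. Qed.

Lemma lambda_01E (R : realType) (M v alpha beta : R) (n : nat) :
  lambda_01 M n v alpha beta
  = lambda_10 M n v alpha beta + (lambda_1s M n alpha beta - lambda_s1 M n alpha beta).
Proof. by rewrite /lambda_01 /lambda_10; set F := _ / (2 * _); lra. Qed.

(** The balance at each [Pt1 i] is [lambda_01E], the balance at [PtStar] is the definition of
    [lambda_s0], and the one at [Pt0] combines the two. *)
Lemma lambda_flow (R : realType) (M v alpha beta : R) (n : nat) (j : Omega n) :
  \sum_(i | i != j) lambda M v alpha beta i j
  = \sum_(i | i != j) lambda M v alpha beta j i.
Proof.
(* The default value 0 of [lambda] on the diagonal allows full sums. *)
have off (F : Omega n -> R) : F j = 0 -> \sum_(i | i != j) F i = \sum_i F i.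
  by move=> Fj; rewrite [RHS](bigD1 j) //= Fj add0r.
rewrite !off; [|by case: j {off}..].
rewrite !big_Omega.
by case: j {off} => [|i|] /=; rewrite !sum_cst ?lambda_01E /lambda_s0; ring.
Qed.

(** * The dual slack as a matrix *)

Definition dot (R : realType) (N : nat) (u w : 'cV[R]_N) : R := (u^T *m w) 0 0.

Lemma dotD (R : realType) (N : nat) (u w w' : 'cV[R]_N) :
  dot u (w + w') = dot u w + dot u w'.
Proof. by rewrite /dot mulmxDr mxE. Qed.

Lemma dotN (R : realType) (N : nat) (u w : 'cV[R]_N) : dot u (- w) = - dot u w.
Proof. by rewrite /dot mulmxN mxE. Qed.

Lemma dotZ (R : realType) (N : nat) (u w : 'cV[R]_N) c : dot u (c *: w) = c * dot u w.
Proof. by rewrite /dot -scalemxAr mxE. Qed.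

Lemma dot0 (R : realType) (N : nat) (u : 'cV[R]_N) : dot u 0 = 0.
Proof. by rewrite /dot mulmx0 mxE. Qed.

Lemma dot_sum (R : realType) (N : nat) (u : 'cV[R]_N) (I : finType)
    (W : I -> 'cV[R]_N) :
  dot u (\sum_i W i) = \sum_i dot u (W i).
Proof. by rewrite /dot mulmx_sumr summxE. Qed.

Lemma qformD (R : realType) (N : nat) (X Y : 'M[R]_N) u :
  qform (X + Y) u = qform X u + qform Y u.
Proof. by rewrite /qform mulmxDr mulmxDl mxE. Qed.

Lemma qformN (R : realType) (N : nat) (X : 'M[R]_N) u : qform (- X) u = - qform X u.
Proof. by rewrite /qform mulmxN mulNmx mxE. Qed.

Lemma qformZ (R : realType) (N : nat) (X : 'M[R]_N) u c :
  qform (c *: X) u = c * qform X u.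
Proof. by rewrite /qform -scalemxAr -scalemxAl mxE. Qed.

Lemma qform_sum (R : realType) (N : nat) (I : finType) (P : pred I)
    (X : I -> 'M[R]_N) u :
  qform (\sum_(i | P i) X i) u = \sum_(i | P i) qform (X i) u.
Proof. by rewrite /qform mulmx_sumr mulmx_suml summxE. Qed.

Lemma qform_rank1 (R : realType) (N : nat) (w u : 'cV[R]_N) :
  qform (w *m w^T) u = dot u w ^+ 2.
Proof.
rewrite /qform /dot mulmxA -mulmxA mxE big_ord1 expr2; congr (_ * _).
by rewrite -[u in w^T *m u]trmxK -trmx_mul mxE.
Qed.

Lemma dot_xbar (R : realType) (n : nat) (alpha : R)
    (u : 'cV[R]_(gram_dim n)) (w : Omega n) :
  dot u (xbar alpha w)
  = sample_x alpha (dot u (ebase R n 0)) (fun i => dot u (gbar0 R i)) w.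
Proof. by case: w => [|i|] /=; rewrite ?dot0 ?dotD ?dotN ?dotZ. Qed.

Lemma dot_gradbar (R : realType) (n : nat) (u : 'cV[R]_(gram_dim n)) (w : Omega n) :
  dot u (gradbar R w)
  = sample_grad (fun i => dot u (gbar0 R i)) (fun i j => dot u (gbar1 R i j)) w.
Proof. by case: w => [|i|] /=; rewrite ?dot0 ?dotZ ?dot_sum. Qed.

Lemma qform_Bbar (R : realType) (M : R) (n : nat) (alpha : R) (i j : Omega n) u :
  qform (Bbar M alpha i j) u
  = interp_form M (dot u (xbar alpha i)) (dot u (xbar alpha j))
      (dot u (gradbar R i)) (dot u (gradbar R j)).
Proof.
rewrite /qform /Bbar !mulmxA -[_ *m u]mulmxA.
have row l : (u^T *m interp_vectors alpha i j) 0 l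
  = dot u (nth 0 [:: xbar alpha i; xbar alpha j; gradbar R i; gradbar R j] l).
  by rewrite /dot !mxE; apply: eq_bigr => k _; rewrite !mxE.
have -> : (interp_vectors alpha i j)^T *m u = (u^T *m interp_vectors alpha i j)^T.
  by rewrite trmx_mul trmxK.
move: (u^T *m _) row => r row.
rewrite mxE; under eq_bigr do rewrite !mxE.
rewrite !big_ord_recl !big_ord0 /= !mxE !row /=.
rewrite /interp_form; ring.
Qed.

Lemma qform_Abar_var0 (R : realType) (n : nat) (u : 'cV[R]_(gram_dim n))
    (g := fun i => dot u (gbar0 R i)) :
  qform (Abar_var0 R n) u = mean (fun i => (g i - mean g) ^+ 2).
Proof.
rewrite /Abar_var0 qformZ qform_sum; congr (_ * _); apply: eq_bigr => i _.
by rewrite qform_rank1 dotD dotN dot_gradbar.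
Qed.

(** Pairing [u] with the basis vectors reduces the matrix inequality to [slack_form] on arbitrary
    scalars. *)
Lemma qform_dual_slack (R : realType) (M : R) (n : nat) (v alpha beta m : R)
    (u : 'cV[R]_(gram_dim n)) :
  qform (dual_slack M n v alpha beta m) u
  = slack_form M v alpha beta m (dot u (ebase R n 0)) (fun i => dot u (gbar0 R i))
      (fun i j => dot u (gbar1 R i j)).
Proof.
rewrite /dual_slack 2!qformD 2!qformN !qformD.
rewrite (qformZ (Abar_R R n)) (qformZ (Abar_var0 R n)) qform_Abar_var0.
rewrite /Cbar qformZ !qform_sum.
rewrite /slack_form /Abar_R qform_rank1; congr (_ + (_ + _) - _ - _ * _).
- apply: eq_bigr => i _; rewrite qformZ /Abar_var1 qformZ qform_sum.
  congr (_ * (_ * _)); apply: eq_bigr => j _.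
  by rewrite qform_rank1 dotD dotN dot_gradbar.
- by apply: eq_bigr => p _; rewrite qformZ qform_Bbar !dot_xbar !dot_gradbar.
- apply: eq_bigr => i _; rewrite qform_sum; apply: eq_bigr => j _.
  by rewrite qform_rank1 !dotD !dotN !dotZ.
Qed.

(** * Symmetry of the dual slack and the semidefinite constraint *)

Lemma trmxZ (R : pzSemiRingType) (m n : nat) (c : R) (X : 'M[R]_(m, n)) :
  (c *: X)^T = c *: X^T.
Proof. by apply/matrixP => i j; rewrite !mxE. Qed.

Lemma trmx_rank1 (R : comPzRingType) (n : nat) (w : 'cV[R]_n) : (w *m w^T)^T = w *m w^T.
Proof. by rewrite trmx_mul trmxK. Qed.

Lemma trmx_sum_sym (R : nmodType) (n : nat) (I : finType) (P : pred I)
    (X : I -> 'M[R]_n) :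
  (forall i, (X i)^T = X i) -> (\sum_(i | P i) X i)^T = \sum_(i | P i) X i.
Proof. by move=> XT; rewrite raddf_sum; apply: eq_bigr => i _; exact: XT. Qed.

Lemma trmx_Bbar (R : realType) (M : R) (n : nat) (alpha : R) (i j : Omega n) :
  (Bbar M alpha i j)^T = Bbar M alpha i j.
Proof.
have symI : (interp_mx M)^T = interp_mx M.
  apply/matrixP => k l; rewrite !mxE.
  by case: k => [[|[|[|[|]]]]] //=; case: l => [[|[|[|[|]]]]].
by rewrite /Bbar !trmx_mul trmxK symI mulmxA.
Qed.

Lemma trmx_dual_slack (R : realType) (M : R) (n : nat) (v alpha beta m : R) :
  (dual_slack M n v alpha beta m)^T = dual_slack M n v alpha beta m.
Proof.
have tr_var1 i : (@Abar_var1 R n i)^T = Abar_var1 R i.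
  by rewrite trmxZ trmx_sum_sym // => j; exact: trmx_rank1.
have tr_var0 : (Abar_var0 R n)^T = Abar_var0 R n.
  by rewrite trmxZ trmx_sum_sym // => j; exact: trmx_rank1.
have tr_C : (Cbar n alpha beta)^T = Cbar n alpha beta.
  rewrite trmxZ trmx_sum_sym // => i; rewrite trmx_sum_sym // => j.
  exact: trmx_rank1.
rewrite /dual_slack !raddfD !raddfN /= tr_C.
rewrite (trmxZ _ (Abar_R R n)) (trmxZ _ (Abar_var0 R n)) tr_var0 trmx_rank1.
rewrite !trmx_sum_sym // => i; first by rewrite trmxZ trmx_Bbar.
by rewrite trmxZ tr_var1.
Qed.

Lemma mean_sqr_eq0 (R : realType) (n : nat) (F : 'I_n -> R) (i : 'I_n) :
  mean (fun j => F j ^+ 2) = 0 -> F i = 0.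
Proof.
move=> F0; apply/eqP; rewrite -sqrf_eq0; apply/eqP.
have n0 : (0 < n)%N by apply: leq_ltn_trans (ltn_ord i).
have := sum_mean (fun j => F j ^+ 2) n0; rewrite F0 mulr0 => /psumr_eq0P; apply => //.
by move=> j _; exact: sqr_ge0.
Qed.

(** The cases are [n = 1], where all deviations vanish; [n > 1] with [v = 0], where [mu0] is
    infinite; and [n > 1] with [v != 0], settled by [mu0_ge]. The scalar form serves both the
    semidefinite constraint and the performance bound. *)
Lemma dual_psdP (R : realType) (M v alpha beta : R) (n : nat)
    (k := variance_ratio n v) (N := n%:R : R) :
  (1 <= n)%N -> 0 <= k ->
  dual_certificate M k alpha beta
    (N * lambda_1s M n alpha beta) (N * lambda_s1 M n alpha beta)
    (N * lambda_01 M n v alpha beta) (N * lambda_10 M n v alpha beta) ->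
  (exists2 m, mu0 M n v alpha beta = m%:E%E
     & forall x g (G : 'I_n -> 'I_n -> R), 0 <= slack_form M v alpha beta m x g G)
  \/ mu0 M n v alpha beta = +oo%E
     /\ forall x g (G : 'I_n -> 'I_n -> R), (forall i, g i - mean g = 0) ->
          0 <= slack_form M v alpha beta 0 x g G.
Proof.
move=> n0 k0 cert.
have mu i := mu1_ge i n0 cert.
have [n1|n1] := leqP n 1.
  have n1E : n = 1%N by apply/eqP; rewrite eqn_leq n1.
  left; exists 0; first by rewrite /mu0 n1E.
  move=> x g G; apply: (slack_form_ge0 _ _ n0 k0 cert) => //; left => i.
  exact: dev_n1.
have [v0|v0] := eqVneq v 0.
  right; split; first by rewrite /mu0 gtn_eqF // v0 eqxx.
  by move=> x g G g0; apply: (slack_form_ge0 _ _ n0 k0 cert) => //; left.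
have [m mE le_m] := mu0_ge n1 v0 cert k0.
by left; exists m => // x g G; apply: (slack_form_ge0 _ _ n0 k0 cert) => //; right.
Qed.

Lemma dual_psd_of_certificate (R : realType) (M v alpha beta : R) (n : nat)
    (k := variance_ratio n v) (N := n%:R : R) :
  (1 <= n)%N -> 0 <= k ->
  dual_certificate M k alpha beta
    (N * lambda_1s M n alpha beta) (N * lambda_s1 M n alpha beta)
    (N * lambda_01 M n v alpha beta) (N * lambda_10 M n v alpha beta) ->
  dual_psd M n v alpha beta.
Proof.
move=> n0 k0 cert; rewrite /dual_psd.
case: (dual_psdP n0 k0 cert) => [[m -> slack0]|[-> slack0]].
  by split; [exact: trmx_dual_slack|move=> u; rewrite qform_dual_slack].
move=> u; rewrite qform_dual_slack qform_Abar_var0.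
set s := mean _; have s0 : 0 <= s by apply: mean_ge0 => i; exact: sqr_ge0.
(* Zero variance forces every deviation to vanish and [+oo * 0 = 0]; positive variance makes the
   whole expression [+oo]. *)
have [s_eq0|s_neq0] := eqVneq s 0.
  rewrite s_eq0 mule0 add0e lee_fin; apply: slack0 => i; exact: mean_sqr_eq0 s_eq0.
by rewrite gt0_mulye ?lte_fin ?lt_neqAle 1?eq_sym ?s_neq0 // addye ?leey.
Qed.

(** * The performance estimation problem *)

Lemma enorm_sqr (R : realType) (d : nat) (x : 'rV[R]_d) :
  enorm x ^+ 2 = \sum_(k < d) x 0 k ^+ 2.
Proof. by rewrite sqr_sqrtr // sumr_ge0 // => k _; exact: sqr_ge0. Qed.

(** The interpolation inequality of the class, scaled by [2 * (M - 1)] and written by coordinates so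
    that it matches [interp_form]. *)
Definition interp_ineq (R : realType) (M : R) (d : nat) (f : 'rV[R]_d -> R) : Prop :=
  forall x y : 'rV[R]_d,
    0 <= 2 * (M - 1) * (f x - f y)
         + \sum_(k < d) interp_form M (x 0 k) (y 0 k)
             (gradient f x 0 k) (gradient f y 0 k).

(** The coefficient of each [F i] is outflow minus inflow, which is zero by [lambda_flow]. *)
Lemma flow_telescopes (R : realType) (M v alpha beta : R) (n : nat) (F : Omega n -> R) :
  \sum_(p : Omega n * Omega n | p.1 != p.2)
     lambda M v alpha beta p.1 p.2 * (F p.1 - F p.2) = 0.
Proof.
under eq_bigr do rewrite mulrBr; rewrite sumrB.
rewrite -(pair_big_dep xpredT (fun i j => i != j)
  (fun i j => lambda M v alpha beta i j * F i)) /=.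
rewrite -(pair_big_dep xpredT (fun i j => i != j)
  (fun i j => lambda M v alpha beta i j * F j)) /=.
rewrite [X in _ - X](exchange_big_dep xpredT) //= -sumrB big1 // => i _.
under [X in X - _]eq_bigl do rewrite eq_sym.
by rewrite -!mulr_suml lambda_flow subrr.
Qed.

(** Weak duality: [slack_form] is summed over the coordinates, the interpolation terms are dropped
    by sign, and the radius and variance constraints bound what remains. *)
Lemma pep_objective_le (R : realType) (M v alpha beta m radius sigma : R) (n : nat)
    (I : pep_instance R n) :
  interp_ineq M (pep_f (p := I)) -> pep_feasible M alpha radius sigma I ->
  (0 < n)%N -> 0 <= tau M n v alpha beta -> 0 <= m ->
  (forall i : 'I_n, 0 <= mu1 M v alpha beta i) ->
  (forall i j : Omega n, 0 <= lambda M v alpha beta i j) ->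
  (forall x g (G : 'I_n -> 'I_n -> R), 0 <= slack_form M v alpha beta m x g G) ->
  pep_objective alpha beta I
  <= tau M n v alpha beta * radius ^+ 2
     + (m * sigma ^+ 2 + \sum_(i < n) mu1 M v alpha beta i * sigma ^+ 2).
Proof.
case: I => d f xs x0 Xi G xi0 xi1 /= interp [/= _ grads x0_le [mean0 var0] unb1].
move=> n0 tau0 m0 mu0 lam0 slack0.
pose g i := G x0 (xi0 i).
pose I := PepInstance f xs x0 G xi0 xi1.
pose x1 i := x0 - alpha *: g i.
pose g1 i j := G (x1 i) (xi1 i j).
pose pt (w : Omega n) := match w with Pt0 => x0 | Pt1 i => x1 i | PtStar => xs end.
pose xk (k : 'I_d) := (x0 - xs) 0 k.
pose gk (k : 'I_d) i := g i 0 k.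
pose Gk (k : 'I_d) i j := g1 i j 0 k.
(* Coordinates are centred at [xs], matching the star placed at the origin in [sample_x]. *)
have ptE k w : sample_x alpha (xk k) (gk k) w = pt w 0 k - xs 0 k.
  case: w => [|i|] /=; last by rewrite subrr.
    by rewrite /xk !mxE.
  by rewrite /xk /x1 /gk !mxE; ring.
have gradE k w : sample_grad (gk k) (Gk k) w = gradient f (pt w) 0 k.
  case: w => [|i|] /=.
  - by rewrite -mean0 !mxE summxE.
  - by rewrite -(unb1 i).1 !mxE summxE.
  - by rewrite grads mxE.
have sumk : 0 <= \sum_(k < d) slack_form M v alpha beta m (xk k) (gk k) (Gk k).
  by apply: sumr_ge0.
have sum_interp : 0 <= \sum_(k < d) \sum_(p : Omega n * Omega n | p.1 != p.2)
      lambda M v alpha beta p.1 p.2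
      * interp_form M (sample_x alpha (xk k) (gk k) p.1)
          (sample_x alpha (xk k) (gk k) p.2)
          (sample_grad (gk k) (Gk k) p.1) (sample_grad (gk k) (Gk k) p.2).
  rewrite exchange_big /=.
  (* Function-value differences can be added at no cost, which makes every summand an instance of
     [interp]. *)
  have flow := flow_telescopes M v alpha beta (fun w => 2 * (M - 1) * f (pt w)).
  rewrite -[leRHS]add0r -[X in _ <= X + _]flow -big_split; apply: sumr_ge0 => /= p _.
  rewrite -mulr_sumr -mulrDr mulr_ge0 // -mulrBr.
  have := interp (pt p.1) (pt p.2); congr (0 <= _ + _); apply: eq_bigr => k _.
  by rewrite !ptE !gradE /interp_form; ring.
rewrite /slack_form !sumrB !big_split /= -!mulr_sumr in sumk; move: sumk.
have -> : \sum_(k < d) xk k ^+ 2 = enorm (x0 - xs) ^+ 2 by rewrite enorm_sqr.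
have -> : \sum_(k < d) \sum_(i < n) (gk k i - mean (gk k)) ^+ 2
    = \sum_(i < n) enorm (G x0 (xi0 i) - gradient f x0) ^+ 2.
  rewrite exchange_big; apply: eq_bigr => i _; rewrite enorm_sqr.
  by apply: eq_bigr => k _; have /= -> := gradE k Pt0; rewrite !mxE.
have -> : \sum_(k < d) \sum_(i < n) mu1 M v alpha beta i
      * mean (fun j => (Gk k i j - mean (Gk k i)) ^+ 2)
    = \sum_(i < n) mu1 M v alpha beta i
      * (n%:R^-1 * \sum_(j < n) enorm (g1 i j - gradient f (x1 i)) ^+ 2).
  rewrite exchange_big; apply: eq_bigr => i _; rewrite -!mulr_sumr.
  congr (_ * (_ * _)); rewrite exchange_big; apply: eq_bigr => j _.
  rewrite enorm_sqr; apply: eq_bigr => k _.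
  by have /= -> := gradE k (Pt1 i); rewrite !mxE.
have -> : (n%:R ^+ 2)^-1 * \sum_(k < d) \sum_(i < n) \sum_(j < n)
      (xk k - alpha * gk k i - beta * Gk k i j) ^+ 2 = pep_objective alpha beta I.
  congr (_ * _); rewrite exchange_big; apply: eq_bigr => i _.
  rewrite exchange_big; apply: eq_bigr => j _; rewrite enorm_sqr.
  apply: eq_bigr => k _; congr (_ ^+ 2).
  by rewrite /pep_x2 /pep_x1 /= -/(g i) -/(x1 i) -/(g1 i j) /Gk /gk /xk /x1 !mxE; ring.
move=> slack_ge0; rewrite -subr_ge0; apply: (le_trans slack_ge0).
(* The nonnegative interpolation sum is replaced by 0. *)
rewrite lerD2r; apply: (le_trans (y := _ - 0)); first by rewrite lerB.
rewrite subr0; apply: lerD; first exact: ler_wpM2l.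
apply: lerD; first exact: ler_wpM2l.
apply: ler_sum => i _; have [_ var1] := unb1 i; exact: (ler_wpM2l (mu0 i) var1).
Qed.

(** * The interpolation inequality *)

Lemma diff_gradient (R : realType) (d : nat) (f : 'rV[R]_d -> R) (x u : 'rV[R]_d) :
  differentiable f x -> 'd f x u = \sum_(k < d) u 0 k * gradient f x 0 k.
Proof.
move=> df; rewrite {1}(row_sum_delta u) linear_sum /=; apply: eq_bigr => k _.
by rewrite linearZ /= mxE deriveE.
Qed.

Lemma is_derive_segment (R : realType) (d : nat) (f : 'rV[R]_d -> R)
    (x u : 'rV[R]_d) (t : R) :
  differentiable f (x + t *: u) ->
  is_derive t 1 (fun s => f (x + s *: u))
    (\sum_(k < d) u 0 k * gradient f (x + t *: u) 0 k).
Proof.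
move=> df.
have dl : is_diff t (fun s : R => x + s *: u) ( *:%R ^~ u).
  have := is_diffD (is_diff_cst x t) (is_diff_scalel t u).
  by move/is_diff_eq; apply; rewrite funeqE => s /=; rewrite add0r.
have := is_diff_comp dl (differentiableP df).
move=> [dc dE]; split.
  by apply/derivable1_diffP; exact: dc.
rewrite deriveE; last exact: dc.
rewrite -diff_gradient // dE /=.
by rewrite scale1r.
Qed.

(** * The Euclidean inner product and the quadratic bounds on [f] *)

Definition edot (R : realType) (d : nat) (x y : 'rV[R]_d) : R :=
  \sum_(k < d) x 0 k * y 0 k.

Lemma edotC (R : realType) (d : nat) (x y : 'rV[R]_d) : edot x y = edot y x.
Proof. by apply: eq_bigr => k _; rewrite mulrC. Qed.

Lemma edotDl (R : realType) (d : nat) (x y z : 'rV[R]_d) :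
  edot (x + y) z = edot x z + edot y z.
Proof. by rewrite -big_split; apply: eq_bigr => k _; rewrite mxE mulrDl. Qed.

Lemma edotZl (R : realType) (d : nat) (c : R) (x y : 'rV[R]_d) :
  edot (c *: x) y = c * edot x y.
Proof. by rewrite /edot mulr_sumr; apply: eq_bigr => k _; rewrite mxE mulrA. Qed.

Lemma edotNl (R : realType) (d : nat) (x y : 'rV[R]_d) : edot (- x) y = - edot x y.
Proof. by rewrite -scaleN1r edotZl mulN1r. Qed.

Lemma edotDr (R : realType) (d : nat) (x y z : 'rV[R]_d) :
  edot z (x + y) = edot z x + edot z y.
Proof. by rewrite edotC edotDl !(edotC z). Qed.

Lemma edotZr (R : realType) (d : nat) (c : R) (x y : 'rV[R]_d) :
  edot y (c *: x) = c * edot y x.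
Proof. by rewrite edotC edotZl (edotC y). Qed.

Lemma edotNr (R : realType) (d : nat) (x y : 'rV[R]_d) : edot y (- x) = - edot y x.
Proof. by rewrite edotC edotNl (edotC y). Qed.

Definition edotE := (edotDl, edotDr, edotNl, edotNr, edotZl, edotZr).

Lemma edot_ge0 (R : realType) (d : nat) (x : 'rV[R]_d) : 0 <= edot x x.
Proof. by apply: sumr_ge0 => k _; rewrite -expr2 sqr_ge0. Qed.

Lemma enorm_edot (R : realType) (d : nat) (x : 'rV[R]_d) : enorm x ^+ 2 = edot x x.
Proof. by rewrite enorm_sqr; apply: eq_bigr => k _; rewrite expr2. Qed.

(** The mean value theorem is applied to [psi], the gap along the segment between [f] and its
    quadratic model; the Lipschitz bound makes its derivative nonpositive. *)
Lemma descent (R : realType) (M : R) (d : nat) (f : 'rV[R]_d -> R) (x u : 'rV[R]_d) :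
  0 < M -> (forall y, differentiable f y) ->
  (forall y z, enorm (gradient f y - gradient f z) <= M * enorm (y - z)) ->
  f (x + u) <= f x + edot u (gradient f x) + M / 2 * edot u u.
Proof.
move=> M0 df lip.
pose A := edot u (gradient f x); pose Q := edot u u.
pose psi (s : R) := f (x + s *: u) - (s * A + M / 2 * Q * s ^+ 2).
pose dpsi (s : R) := edot u (gradient f (x + s *: u)) - (A + M * Q * s).
have dpsiP (s : R) : is_derive s (1 : R) psi (dpsi s).
  apply: is_deriveB; first exact: is_derive_segment.
  by apply: is_derive_eq; rewrite scaler0 add0r /GRing.scale /=; field.
have [|c /[!in_itv] /= /andP[c0 c1] psiE] :=
  @MVT _ psi dpsi 0 1 ltr01 (fun s _ => dpsiP s).
  apply: derivable_within_continuous => s _; exact: ex_derive.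
have : psi 1 - psi 0 <= 0.
  rewrite psiE subr0 mulr1 /dpsi.
  have Mc : 0 < M * c by rewrite mulr_gt0.
  pose w := gradient f (x + c *: u) - gradient f x.
  have le_w : edot w w <= (M * c) ^+ 2 * Q.
    have := lip (x + c *: u) x; rewrite -/w (addrC x) addrK.
    have : 0 <= enorm w by exact: sqrtr_ge0.
    have : 0 <= M * enorm (c *: u) by rewrite mulr_ge0 ?sqrtr_ge0 ?ltW.
    move=> Mu0 w0 le_w; rewrite -enorm_edot.
    have -> : (M * c) ^+ 2 * Q = (M * enorm (c *: u)) ^+ 2.
      by rewrite [RHS]exprMn enorm_edot !edotE -/Q; ring.
    exact: lerXn2r.
  have wE : edot u w = edot u (gradient f (x + c *: u)) - A by rewrite !edotE.
  move: w le_w wE => w le_w wE.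
  (* This square stands in for Cauchy-Schwarz: with [le_w] it gives [edot u w <= M * c * Q]. *)
  have := edot_ge0 (w - (M * c) *: u); rewrite !edotE (edotC w u) -/Q => sq.
  have : 0 <= 2 * (M * c) * (M * c * Q - edot u w) by lra.
  rewrite pmulr_rge0 ?mulr_gt0 // wE; lra.
rewrite /psi !scale1r !scale0r addr0 -/A -/Q; lra.
Qed.

(** Strong convexity bounds each chord slope from [x] towards [x + u]; letting the step tend to 0
    from the right gives the tangent bound. *)
Lemma strongly_convex_tangent (R : realType) (d : nat) (f : 'rV[R]_d -> R)
    (x u : 'rV[R]_d) :
  differentiable f x -> strongly_convex 1 f ->
  f x + edot u (gradient f x) + edot u u / 2 <= f (x + u).
Proof.
move=> df scf.
have chord (t : R) : 0 < t -> t <= 1 ->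
    t^-1 * (f (x + t *: u) - f x)
    <= f (x + u) - f x - edot u u / 2 + t * (edot u u / 2).
  move=> t0 t1; rewrite ler_pdivrMl //.
  have := scf (Itv01 (ltW t0) t1) (x + u) x; rewrite !in_setT => /(_ isT isT).
  rewrite convRE /=.
  have -> : conv (Itv01 (ltW t0) t1) (x + u : convex_lmodType 'rV[R]_d) x = x + t *: u.
    rewrite /conv /= /unstable.onem scalerDr addrAC -scalerDl (addrC t) subrK scale1r.
    by [].
  rewrite !enorm_edot !edotE /unstable.onem (edotC u x); lra.
have xE : x + 0 *: u = x by rewrite scale0r addr0.
have [dv dE] : is_derive (0 : R) (1 : R) (fun s => f (x + s *: u))
    (edot u (gradient f x)).
  by rewrite -[in gradient f x]xE; apply: is_derive_segment; rewrite xE.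
(* Subtracting the term linear in [t] gives a bound independent of [t] without changing the
   limit. *)
pose q (t : R) := t^-1 * (f (x + t *: u) - f x) - t * (edot u u / 2).
have q_cvg :
    (q t @[t --> 0^'+] --> edot u (gradient f x) - 0 * (edot u u / 2))%classic.
  apply: cvgB; last first.
    apply: cvgMr_tmp.
    exact: cvg_at_right_filter cvg_id.
  apply: cvg_dnbhs_at_right; rewrite -dE.
  rewrite [X in (X t @[t --> _] --> _)%classic](_ : _ = fun t => t^-1 *:
    (((fun s => f (x + s *: u)) \o shift 0) (t *: 1) - f (x + 0 *: u))).
    exact: dv.
  by apply/funext => t /=; rewrite addr0 scale0r addr0 [t%:A]mulr1.
rewrite mul0r subr0 in q_cvg.
suff : edot u (gradient f x) <= f (x + u) - f x - edot u u / 2 by lra.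
apply: (cvgr_to_le q_cvg); near=> t; rewrite /q lerBlDr.
apply: chord; near: t; [exact: nbhs_right_gt|exact: nbhs_right_le].
Unshelve. all: by end_near.
Qed.

(* The tangent bound at [y] and the descent bound at [x] are compared at
   [x - c D], which minimizes the difference of the two quadratics. *)
Lemma class_F1_interp (R : realType) (M : R) (d : nat) (f : 'rV[R]_d -> R) :
  1 < M -> class_F1 M f -> interp_ineq M f.
Proof.
move=> M1 [_ scf df lip] x y.
have M0 : 0 < M by lra.
pose dx := x - y; pose c := (M - 1)^-1.
pose D := gradient f x - gradient f y - dx.
have cM : c * (M - 1) = 1 by rewrite mulVf // subr_eq0 gt_eqF.
have upper := descent x (- (c *: D)) M0 df lip.
have lower := strongly_convex_tangent (x - y - c *: D) (df y) scf.
have xE : y + (x - y - c *: D) = x + - (c *: D) by rewrite addrA (addrC y) subrK.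
rewrite xE -/dx in lower.
have gxE : gradient f x = gradient f y + (dx + D).
  by rewrite (addrC dx) subrK addrC subrK.
have -> : \sum_(k < d) interp_form M (x 0 k) (y 0 k)
    (gradient f x 0 k) (gradient f y 0 k)
  = - M * edot dx dx - edot (dx + D) (dx + D)
    + 2 * edot dx (gradient f y + (dx + D) - M *: gradient f y).
  rewrite -gxE.
  have -> : dx + D = gradient f x - gradient f y by rewrite /D addrC subrK.
  rewrite /edot mulr_sumr -sumrB mulr_sumr -big_split; apply: eq_bigr => k _.
  by rewrite /interp_form /dx !mxE /=; ring.
move: (le_trans lower upper); rewrite gxE.
clear lower upper xE gxE; clearbody D; clearbody dx; move: (gradient f y) => gy.
rewrite -subr_ge0; set B := (X in 0 <= X) => bound.
have BE : B = f x - f y - edot dx gy - edot dx dx / 2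
    + (c * (M - 1) / 2 - 1) * c * edot D D.
  by rewrite /B !edotE (edotC D dx); field.
have : 0 <= 2 * (M - 1) * B by rewrite mulr_ge0 //; lra.
(* Now [c] occurs only in the product [c * (M - 1) = 1], which leaves [- edot D D]. *)
have -> : 2 * (M - 1) * B
    = 2 * (M - 1) * (f x - f y - edot dx gy - edot dx dx / 2)
      + 2 * (c * (M - 1)) * (c * (M - 1) / 2 - 1) * edot D D by rewrite BE; ring.
by rewrite cM !edotE (edotC D dx); lra.
Qed.

Theorem theorem3p2 (R : realType) (M : R) (n : nat) (v alpha beta : R)
    (hM : 1 < M) (hn : (1 <= n)%N) (hv0 : 0 <= v)
    (hv : (1 < n)%N -> v <= ((M - 1) * n%:R) / ((n%:R - 1) * M))
    (halpha : is_alpha_star M n v alpha)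
    (hbeta : is_beta_star M n v alpha beta) :
  [/\
    [/\ 0 <= tau M n v alpha beta,
        (0 <= mu0 M n v alpha beta)%E,
        forall i : 'I_n, 0 <= mu1 M v alpha beta i &
        forall i j : Omega n, i != j -> 0 <= lambda M v alpha beta i j],
    dual_psd M n v alpha beta /\
    (forall j : Omega n,
       \sum_(i : Omega n | i != j) lambda M v alpha beta i j
       = \sum_(i : Omega n | i != j) lambda M v alpha beta j i) &
    forall radius sigma : R, 0 < radius -> 0 < sigma ->
      (pep_value M n alpha beta radius sigma
         <= dual_bound M n v alpha beta radius sigma)%E /\
      (forall I : pep_instance R n, pep_feasible M alpha radius sigma I ->
         ((pep_objective alpha beta I)%:E
            <= dual_bound M n v alpha beta radius sigma)%E)].
Proof.
have cert := multipliers_certificate hM hn hv0 hv halpha hbeta.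
have /andP[k0 _] := variance_ratio_bounds hM hn hv0 hv.
have tau0 := tau_ge0 cert.
have lam0 := lambda_ge0 hn cert.
have mu0_0 : (0 <= mu0 M n v alpha beta)%E.
  rewrite /mu0; case: ifP => // _; case: ifP => // _.
  by rewrite lee_fin le_max lexx.
have mu1_0 (i : 'I_n) : 0 <= mu1 M v alpha beta i.
  by rewrite /mu1; case: ifP => // _; rewrite le_max lexx.
split.
- by split => // i j _; exact: lam0.
- split; first exact: dual_psd_of_certificate k0 cert.
  by move=> j; exact: lambda_flow.
move=> radius sigma _ sigma0.
have bound (I : pep_instance R n) : pep_feasible M alpha radius sigma I ->
    ((pep_objective alpha beta I)%:E <= dual_bound M n v alpha beta radius sigma)%E.
  move=> feas; rewrite /dual_bound.
  case: (dual_psdP hn k0 cert) => [[m mE slack0]|[mE _]]; last first.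
    (* With [mu0] infinite and [sigma > 0] the bound itself is [+oo]. *)
    by rewrite mE gt0_mulye ?lte_fin ?exprn_gt0 // addye // addey // leey.
  rewrite mE -EFinM -!EFinD lee_fin.
  have [F1 _ _ _ _] := feas.
  apply: pep_objective_le => //; first exact: class_F1_interp.
  by rewrite -lee_fin -mE.
by split => //; apply: ge_ereal_sup => _ [I feas <-]; exact: bound.
Qed.
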